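(* For all $t\in\mathbb C$ we have, as $n\to+\infty$, $$\mathbb E_{n,\infty,1/2}\left(t^{\mathrm K_n}\right)=(2n)^{\frac{t-1}{2}}\cdot\frac{t\cdot\Gamma(\frac32)}{\Gamma(1+\frac t2)}\left(1+O\left(\frac1n\right)\right),$$ where the error term is uniform for $t$ in any compact subset of $\mathbb C$.
   Context: For a permutation $\sigma\in S_n$ with $\mu_j$ cycles of length $j$ ($j=1,\dots,n$) put $w(\sigma)=\prod_{j=1}^n\theta_j^{\mu_j}$ with $\theta_j=\zeta(2j)/2$, where $\zeta$ is the Riemann zeta function. $\mathbb P_{n,\infty,1/2}$ is the probability measure on the symmetric group $S_n$ with $\mathbb P_{n,\infty,1/2}(\sigma)=w(\sigma)/\sum_{\tau\in S_n}w(\tau)$, and $\mathbb E_{n,\infty,1/2}$ is the corresponding expectation. $\mathrm K_n(\sigma)$ is the number of disjoint cycles in the cycle decomposition of $\sigma$. $\Gamma$ is the Euler Gamma function, and $1/\Gamma$ is understood as an entire function.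
   Formalization: At t = -2, -4, ... the right side is 0 but the expectation need not be (it is nonzero at t = -2), so the factor (1+O(1/n)) is proved uniformly on compacts avoiding these points; on all compacts of C it is proved with 1/Γ(1+t/2)+O(1/n) in place of (1/Γ(1+t/2))(1+O(1/n)). *)

(* Defs.v *)
From HB Require Import structures.
From mathcomp Require Import all_boot all_order all_algebra all_fingroup.
From mathcomp Require Import all_classical all_reals all_analysis complex.

Set Implicit Arguments.
Unset Strict Implicit.
Unset Printing Implicit Defensive.

Import Order.TTheory GRing.Theory Num.Theory.
Import numFieldNormedType.Exports.

Local Open Scope classical_set_scope.
Local Open Scope ring_scope.
Local Open Scope complex_scope.

(* The usual topology of the complex plane, given by the modulus; the library
   only declares it on the regular module [R[i]^o]. *)
HB.instance Definition _ (R : realType) := PseudoMetricNormedZmod.copy R[i] R[i]^o.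

(* Dirichlet series of the Riemann zeta function; it converges for [1 < s],
   and is only used for such [s]. *)
Definition zeta (R : realType) (s : R) : R :=
  limn (series (fun m : nat => m.+1%:R `^ (- s))).

(* [exp (z * ln x)], with the real logarithm; meant for [0 < x]. *)
Definition cpow (R : realType) (x : R) (z : R[i]) : R[i] :=
  (expR (complex.Re z * ln x))%:C *
  (cos (complex.Im z * ln x) +i* sin (complex.Im z * ln x)).

(* The entire function [1 / Gamma], by the reciprocal of Euler's limit
   [Gamma z = lim_n n! n^z / (z (z + 1) ... (z + n))]. *)
Definition rGamma (R : realType) (z : R[i]) : R[i] :=
  limn (fun n : nat =>
    (\prod_(0 <= k < n.+1) (z + k%:R)) / (n`!%:R * cpow n%:R z)).

Definition Gamma (R : realType) (z : R[i]) : R[i] := (rGamma z)^-1.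

Definition theta (R : realType) (j : nat) : R := zeta (2 * j)%:R / 2.

(* The cycles of a permutation, fixed points included, are the elements of
   [porbits s]. *)
Definition cycle_count n (s : 'S_n) (j : nat) : nat :=
  #|[set c in porbits s | #|c| == j]%SET|.

Definition ncycles n (s : 'S_n) : nat := #|porbits s|.

Definition weight (R : realType) n (s : 'S_n) : R :=
  \prod_(1 <= j < n.+1) theta R j ^+ cycle_count s j.

Definition perm_prob (R : realType) n (s : 'S_n) : R :=
  weight R s / \sum_(u : 'S_n) weight R u.

Definition expect (R : realType) n (f : 'S_n -> R[i]) : R[i] :=
  \sum_(s : 'S_n) (perm_prob R s)%:C * f s.

(* [err n t = O(1/n)], uniformly for [t] in any compact subset of [D]. *)
Definition compactly_bigO_inv (R : realType) (D : set R[i])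
    (err : nat -> R[i] -> R[i]) : Prop :=
  forall A : set R[i], compact A -> A `<=` D ->
  exists (M : R) (n0 : nat), forall (n : nat) (t : R[i]),
    (n0 <= n)%N -> A t -> `|err n t| <= (M / n%:R)%:C.

(* The zeros [-2, -4, -6, ...] of [t |-> 1 / Gamma (1 + t / 2)]. *)
Definition rGamma_zeros (R : realType) : set R[i] :=
  [set t | exists k : nat, t = - (2 * k.+1)%:R].

(* Main.v *)
(* Put [s = t / 2] and let [a_n(s)] be the coefficient of [x^n] in
   [exp (s \sum_j zeta(2j) x^j / j)].  Removing the elements of the cycle of a
   chosen point one after the other shows that
   [n! a_n(s) = \sum_sigma w(sigma) t^(K sigma)], so the expectation is
   [a_n(t / 2) / a_n(1 / 2)].  Since [zeta(2j) = 1 + O(4^-j)], the series factors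
   as [(1 - x)^-s F_s(x)], where [F_s] converges beyond [x = 1] and
   [F_s(1) = 2^s] because [\sum_j (zeta(2j) - 1) / j = ln 2], by telescoping.
   The coefficients of [(1 - x)^-s] are [s n^(s-1) (1 / Gamma(1 + s) + O(1/n))],
   uniformly for [s] in a compact set, and convolving them with the
   exponentially small coefficients of [F_s] gives
   [a_n(s) = s n^(s-1) (2^s / Gamma(1 + s) + O(1/n))]. *)
Require Import Defs.
From mathcomp Require Import all_boot all_order all_algebra all_fingroup.
From mathcomp Require Import all_classical all_reals all_analysis complex.
From mathcomp Require Import ring lra zify.

Import Order.TTheory GRing.Theory Num.Theory.
Import numFieldNormedType.Exports.

Local Open Scope classical_set_scope.
Local Open Scope ring_scope.
Local Open Scope complex_scope.

(** * Sums of cycle weights over the permutations of a finite set *)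

Section CycleWeights.
Set Implicit Arguments.
Unset Strict Implicit.
Local Close Scope classical_set_scope.
Local Close Scope complex_scope.
Variables (K : numFieldType) (T : finType) (y : nat -> K).
Implicit Types (A : {set T}) (x i z : T) (s : {perm T}) (k n : nat).

(** Uniformity in [t] shapes the proof: limits come with explicit rates [c / n], where [c] depends
    on [t] only through a bound on its modulus. The rates come from increments bounded by
    [c * (1/n - 1/(n+1))], which telescope. A series [A = exp (\sum_j y_j x^j / j)] is handled
    through the recursion [n a_n = \sum_j y_j a_(n-j)], that is [x A' = Y A], so neither composition
    of series nor contour integrals occur. The value [F_s(1) = exp (s L)] follows from
    [F_(z+w) = F_z F_w] and the first-order behaviour of [F_h(1)] at [h = 0]. Expanding
    [zeta(2j) - 1] as the sum of the [m^(-2j)] with [m >= 2] turns [L] into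
    [- \sum_m ln (1 - m^-2)], a telescoping sum. The factor [s] is kept outside every error term, so
    that dividing by [t] costs nothing near 0. The error is first absolute with respect to
    [1 / Gamma (1 + t/2)]; a lower bound for this factor on compact sets avoiding its zeros makes it
    relative. *)

Definition cycle_weight_sum A : K :=
  \sum_(s | perm_on A s) \prod_(c in porbit s @: A) y #|c|.

(* The cycle of [x] is weighted as if it had [k] more elements, so that
   removing the image of [x] from its cycle gives a recursion. *)
Definition shifted_weight_sum A x k : K :=
  \sum_(s | perm_on A s)
    y (#|porbit s x| + k) *
      \prod_(c in (porbit s @: A) :\ porbit s x) y #|c|.

Lemma cycle_weight_sum_shift0 A x : x \in A ->
  cycle_weight_sum A = shifted_weight_sum A x 0.
Proof.
move=> xA; apply: eq_bigr => s _.
by rewrite (big_setD1 (porbit s x)) ?imset_f //= addn0.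
Qed.

Lemma porbit_fix s x : s x = x -> porbit s x = [set x].
Proof.
move=> sx; apply/setP => z; rewrite inE; apply/porbitP/eqP => [[j ->]|->].
  by rewrite permX; elim: j => //= j ->.
by exists 0%N; rewrite expg0 perm1.
Qed.

(** Products of permutations apply the left factor first, so [tperm x (s x) * s] fixes [s x] and
    sends [x] to [s (s x)]: it cuts [s x] out of its cycle and changes nothing else. *)
Lemma porbit_bypass s x z : s x != x -> z != s x ->
  porbit (tperm x (s x) * s)%g z = porbit s z :\ s x.
Proof.
move=> sxx zi; set i := s x; set s' := (_ * _)%g.
have s'i : s' i = i by rewrite /s' permM tpermR.
have s'x : s' x = s i by rewrite /s' permM tpermL.
have s'o w : w != x -> w != i -> s' w = s w.
  by move=> wx wi; rewrite /s' permM tpermD // eq_sym.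
apply/setP => w; rewrite !inE; apply/idP/andP.
- move/porbitP => [j ->]; rewrite permX; elim: j => [|j [IH1 IH2]] /=.
    by rewrite zi porbit_id.
  set v := iter j s' z in IH1 IH2 *; split.
    by rewrite -s'i (inj_eq perm_inj).
  have [vx|vx] := eqVneq v x; last first.
    by rewrite s'o // -eq_porbit_mem (porbit_perm s 1) eq_porbit_mem.
  rewrite vx s'x -eq_porbit_mem (porbit_perm s 1) (porbit_perm s 1 x).
  by rewrite eq_porbit_mem -vx.
- case=> wi /porbitP[j wE]; move: wi; rewrite {}wE permX.
  elim/ltn_ind: j => -[|j] IH; first by rewrite porbit_id.
  rewrite iterS => wi.
  have [vi|vi] := eqVneq (iter j s z) i; last first.
    have vx : iter j s z != x by apply: contra wi => /eqP ->.
    by rewrite -s'o // -eq_porbit_mem (porbit_perm s' 1) eq_porbit_mem IH.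
  (* The previous iterate is the removed point, so the one before it is [x], from which [s'] jumps
     over the removed point. *)
  case: j IH vi wi => [|j] IH; first by move=> /= zi'; rewrite zi' eqxx in zi.
  rewrite iterS => vx _; have {}vx : iter j s z = x by apply: (@perm_inj _ s).
  rewrite vx -/i -s'x -eq_porbit_mem (porbit_perm s' 1) eq_porbit_mem -vx IH //.
  by rewrite vx eq_sym.
Qed.
Lemma porbits_fix A s x : x \in A -> s x = x ->
  (porbit s @: A) :\ porbit s x = porbit s @: (A :\ x).
Proof.
move=> xA sx; apply/setP => c; rewrite !inE; apply/andP/imsetP.
  case=> cx /imsetP[z zA cE]; exists z => //; rewrite !inE zA andbT.
  by apply: contra cx => /eqP <-; rewrite cE.
case=> z; rewrite !inE => /andP[zx zA] ->; split; last exact: imset_f.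
by rewrite eq_porbit_mem (porbit_fix sx) inE.
Qed.

(** A cycle avoiding [x] also avoids [s x], so the bypass leaves it intact. *)
Lemma porbits_bypass A s x : x \in A -> s x != x ->
  let s' := (tperm x (s x) * s)%g in
  (porbit s @: A) :\ porbit s x = (porbit s' @: (A :\ s x)) :\ porbit s' x.
Proof.
move=> xA sxx s'; set i := s x.
have pE z : z != i -> porbit s' z = porbit s z :\ i by exact: porbit_bypass.
have ixP z : (i \in porbit s z) = (x \in porbit s z).
  by rewrite -!eq_porbit_mem (porbit_perm s 1 x).
have xi : x != i by rewrite eq_sym.
apply/setP => c; rewrite !inE; apply/andP/andP; case=> cx /imsetP[z zA cE].
  move: cx; rewrite cE eq_sym eq_porbit_mem => xz.
  have zi : z != i by apply: contra xz => /eqP ->; rewrite -ixP porbit_id.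
  have zE : porbit s' z = porbit s z.
    rewrite pE //; apply/setP => w; rewrite !inE.
    by have [->|//] := eqVneq w i; rewrite ixP (negbTE xz).
  split; last by rewrite -zE imset_f // !inE zi.
  by rewrite eq_sym -zE eq_porbit_mem zE.
move: zA; rewrite !inE => /andP[zi zA].
move: cx; rewrite cE eq_sym eq_porbit_mem pE // !inE xi /= => xz.
have -> : porbit s z :\ i = porbit s z.
  apply/setP => w; rewrite !inE.
  by have [->|//] := eqVneq w i; rewrite ixP (negbTE xz).
by rewrite imset_f // eq_sym eq_porbit_mem.
Qed.

Lemma perm_on_fix A s x : s x = x -> perm_on A s = perm_on (A :\ x) s.
Proof.
move=> sx; apply/idP/idP => /fintype.subsetP sA; apply/fintype.subsetP => z sz; last first.
  by move/sA: sz; rewrite !inE => /andP[].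
rewrite !inE sA // andbT; move: sz; rewrite inE.
by apply: contraNneq => ->; rewrite sx.
Qed.

Lemma perm_on_tperm_mul A s x i : x \in A -> i \in A ->
  perm_on A (tperm x i * s)%g = perm_on A s.
Proof.
move=> xA iA.
have tA : perm_on A (tperm x i).
  apply/fintype.subsetP => z; rewrite inE; case: tpermP => [-> _|-> _|] //.
  by rewrite eqxx.
apply/idP/idP => [h|]; last exact: perm_onM.
by rewrite -[s](mulKg (tperm x i)) tpermV perm_onM.
Qed.

(** Either [x] is fixed, and its cycle counts as [k + 1] elements, or its image [i] is cut out of
    the cycle; the lost element is recorded by raising the shift to [k + 1]. *)
Lemma shifted_weight_sum_rec A x k : x \in A ->
  shifted_weight_sum A x k =
    y k.+1 * cycle_weight_sum (A :\ x) +
    \sum_(i in A :\ x) shifted_weight_sum (A :\ i) x k.+1.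
Proof.
move=> xA; rewrite /shifted_weight_sum (bigID (fun s => s x == x)) /=.
congr (_ + _).
  rewrite mulr_sumr; apply: eq_big => [s|s /andP[_ /eqP sx]]; last first.
    by rewrite porbits_fix // (porbit_fix sx) cards1 add1n.
  apply/andP/idP => [[h /eqP sx]|h]; first by rewrite -(perm_on_fix _ sx).
  have sx : s x = x by apply: out_perm h _; rewrite !inE eqxx.
  by rewrite sx eqxx (perm_on_fix A sx) h.
rewrite (partition_big (fun s => s x) [in A :\ x]) /=; last first.
  by move=> s /andP[sA sx]; rewrite !inE sx perm_closed.
apply: eq_bigr => i; rewrite !inE => /andP[ix iA].
(* The new [s] is the permutation after the cut: the condition that the old one sends [x] to [i]
   becomes [s i = i]. *)
rewrite (reindex_inj (mulgI (tperm x i))) /=.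
apply: eq_big => [s|s /andP[_ /eqP sx]].
  rewrite perm_on_tperm_mul // permM tpermL.
  apply/andP/idP => [[/andP[sA _] /eqP si]|h].
    by rewrite -(perm_on_fix _ si).
  have si : s i = i by apply: out_perm h _; rewrite !inE eqxx.
  by rewrite si eqxx ix (perm_on_fix _ si) h.
set r := (_ * s)%g in sx *.
have rx : r x != x by rewrite sx.
have rs : (tperm x (r x) * r)%g = s.
  by rewrite sx /r -{1}tpermV mulKg.
have := porbits_bypass xA rx; rewrite rs => ->; rewrite sx.
have xi : x != r x by rewrite eq_sym.
have := porbit_bypass rx xi; rewrite rs => ->.
rewrite addnS -addSn (cardsD1 (r x) (porbit r x)) (mem_porbit r 1).
by rewrite add1n.
Qed.

End CycleWeights.

(** * Coefficients of exponentials of power series *)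

Section ExpSeq.
Set Implicit Arguments.
Unset Strict Implicit.
Variable K : numFieldType.
Implicit Types (y a b : nat -> K).

(* [a] is the coefficient sequence of [exp (\sum_(j > 0) y_j x^j / j)]. *)
Definition expseq y a := a 0%N = 1 /\
  forall n, n.+1%:R * a n.+1 = \sum_(j < n.+1) y j.+1 * a (n - j)%N.

Lemma expseq_exists y : exists a, expseq y a.
Proof.
(* [l n] lists [a_n, ..., a_0] in this order, so its entry [j] is [a_(n-j)], as the recursion
   wants. *)
pose l := fix l n : seq K := if n is m.+1 then
  (m.+1%:R^-1 * \sum_(j < m.+1) y j.+1 * (l m)`_j) :: l m else [:: 1].
exists (fun n => (l n)`_0); split=> // n.
have lE m j : (j <= m)%N -> (l m)`_j = (l (m - j)%N)`_0.
  by elim: m j => [|m IH] [|j] //= jm; rewrite subSS IH.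
rewrite /= mulrA divff ?pnatr_eq0 // mul1r.
by apply: eq_bigr => j _; rewrite lE // -ltnS.
Qed.

Lemma expseq_unique y a b : expseq y a -> expseq y b -> a =1 b.
Proof.
move=> [a0 aS] [b0 bS]; elim/ltn_ind => -[|n] IH; first by rewrite a0 b0.
apply: (@mulfI _ n.+1%:R); first by rewrite pnatr_eq0.
rewrite aS bS; apply: eq_bigr => j _; rewrite IH //.
by rewrite ltnS leq_subr.
Qed.

Definition seq_conv a b n := \sum_(j < n.+1) a j * b (n - j)%N.

(** The recursion expresses the logarithmic derivative, which is additive on products. Truncating
    the series to polynomials gives access to the product rule. *)
Lemma expseq_conv y y' a b : expseq y a -> expseq y' b ->
  expseq (fun j => y j + y' j) (seq_conv a b).
Proof.
move=> [a0 aS] [b0 bS]; split; first by rewrite /seq_conv big_ord1 a0 b0 mulr1.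
move=> n; pose P f : {poly K} := \poly_(i < n.+2) f i.
have PE f i : (i < n.+2)%N -> (P f)`_i = f i by move=> h; rewrite coef_poly h.
have cM (f g : nat -> K) i : (i < n.+2)%N ->
    (P f * P g)`_i = \sum_(j < i.+1) f j * g (i - j)%N.
  move=> h; rewrite coefM; apply: eq_bigr => j _; rewrite !PE //.
    by rewrite (leq_ltn_trans (leq_subr _ _)).
  by rewrite (leq_ltn_trans _ h) // -ltnS.
have dE (f g : nat -> K) : (forall n, n.+1%:R * f n.+1 = \sum_(j < n.+1) g j.+1 * f (n - j)%N) ->
    forall i, (i <= n)%N -> (P f)^`()`_i = (P (g \o S) * P f)`_i.
  move=> fS i h; rewrite coef_deriv cM ?ltnS ?(leqW h) // PE // -fS.
  by rewrite mulr_natl.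
(* The truncated differential equation holds only up to degree [n], which is all that coefficient
   [n] of a product sees. *)
have trunc (f g h : {poly K}) : (forall i, (i <= n)%N -> f`_i = g`_i) ->
    (f * h)`_n = (g * h)`_n.
  move=> fg; rewrite !coefM; apply: eq_bigr => j _; rewrite fg //.
  by rewrite -ltnS.
have -> : n.+1%:R * seq_conv a b n.+1 = (P a * P b)^`()`_n.
  by rewrite coef_deriv cM // mulr_natl.
rewrite derivM coefD (trunc _ _ _ (dE a y aS)).
rewrite [P a * _]mulrC (trunc _ _ _ (dE b y' bS)) -coefD.
rewrite -mulrA -[_ * P b * P a]mulrA [P b * P a]mulrC -mulrDl.
have -> : P (y \o S) + P (y' \o S) = P ((fun j => y j + y' j) \o S).
  apply/polyP => i; rewrite coefD !coef_poly; case: ifP => // _; exact: addr0.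
rewrite coefM; apply: eq_bigr => j _; rewrite PE /=; last first.
  by rewrite (leq_trans (ltn_ord j)).
by congr (_ * _); rewrite cM // ltnS (leq_trans (leq_subr _ _)).
Qed.

(** The induction on the size of [A] needs the shifted sums too. In their formula, term [j] accounts
    for the permutations in which the cycle of [x] has [j + 1] elements. *)
Lemma cycle_weight_sum_expseq (T : finType) y a (A : {set T}) : expseq y a ->
  cycle_weight_sum y A = (#|A|)`!%:R * a #|A|.
Proof.
move=> [a0 aS]; suff: forall n (A : {set T}), #|A| = n ->
    cycle_weight_sum y A = n`!%:R * a n /\
    forall x k, x \in A -> shifted_weight_sum y A x k =
      n.-1`!%:R * \sum_(j < n) y (j + k).+1 * a (n.-1 - j)%N.
  by move=> h; have [-> _] := h _ _ (erefl #|A|).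
elim/ltn_ind => -[|n] IH {}A cA.
  have A0 : A = finset.set0 by apply/eqP; rewrite -cards_eq0 cA.
  split; last by move=> x k; rewrite A0 inE.
  rewrite /cycle_weight_sum (big_pred1 1%g) => [|s]; last first.
    rewrite A0; apply/idP/eqP => [h|->]; last exact: perm_on1.
    by apply/permP => z; rewrite perm1 (out_perm h) // inE.
  by rewrite A0 imset0 big_set0 a0 mulr1.
have cD x : x \in A -> #|A :\ x| = n.
  by move=> xA; move: cA; rewrite (cardsD1 x) xA add1n => -[].
have S x k : x \in A -> shifted_weight_sum y A x k =
      n`!%:R * \sum_(j < n.+1) y (j + k).+1 * a (n - j)%N.
  move=> xA; rewrite shifted_weight_sum_rec //.
  have [-> _] := IH n (ltnSn n) _ (cD x xA).
  have -> : \sum_(i in A :\ x) shifted_weight_sum y (A :\ i) x k.+1 =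
     \sum_(i in A :\ x) n.-1`!%:R * \sum_(j < n) y (j + k.+1).+1 * a (n.-1 - j)%N.
    apply: eq_bigr => i; rewrite !inE => /andP[ix iA].
    have [_ ->] // := IH n (ltnSn n) _ (cD i iA).
    by rewrite !inE eq_sym ix.
  (* Term 0 is the case where [x] is fixed; the [n] choices of an image of [x] turn [(n-1)!] into
     [n!] in the others. *)
  rewrite sumr_const cD // big_ord_recl /= subn0 add0n mulrDr; congr (_ + _).
    by rewrite mulrCA.
  case: n {IH cA cD} => [|n]; first by rewrite mulr0n !big_ord0 mulr0.
  rewrite -mulrnAl -mulrnA mulnC -factS; congr (_ * _).
  by apply: eq_bigr => j _; rewrite /= addnS.
split=> //.
have [x xA] : exists x, x \in A by apply/set0Pn; rewrite -cards_eq0 cA.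
rewrite (cycle_weight_sum_shift0 _ xA) S // factS natrM -[RHS]mulrA mulrCA aS.
by congr (_ * _); apply: eq_bigr => j _; rewrite addn0.
Qed.

End ExpSeq.

(** * The expectation as a quotient of two coefficients *)

Section Expectation.
Set Implicit Arguments.
Unset Strict Implicit.
Local Close Scope classical_set_scope.
Variable R : realType.
Local Notation C := R[i].

Lemma weightE n (s : 'S_n) :
  weight R s = \prod_(c in porbits s) theta R #|c|.
Proof.
rewrite /weight (partition_big (fun c : {set 'I_n} => inord #|c| : 'I_n.+1) xpredT) //=.
have cE (c : {set 'I_n}) : #|c| = (inord #|c| : 'I_n.+1).
  by rewrite inordK // ltnS -[leqRHS]card_ord max_card.
rewrite big_add1 /= big_mkord big_ord_recl [X in X * _]big1 ?mul1r.
  apply: eq_bigr => j _; rewrite /cycle_count -prodr_const; apply: eq_big.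
    by move=> c; rewrite !inE -val_eqE /= -cE.
  by move=> c; rewrite !inE => /andP[_ /eqP ->].
move=> c /andP[/imsetP[x _ ->]]; rewrite -val_eqE /= -cE => h.
by have := card_porbit_neq0 s x; rewrite h.
Qed.

Lemma cycle_weight_sumT n (y : nat -> C) :
  cycle_weight_sum y [set: 'I_n] = \sum_(s : 'S_n) \prod_(c in porbits s) y #|c|.
Proof.
apply: eq_big => [s|s _]; first by apply/fintype.subsetP => x; rewrite inE.
apply: eq_bigl => c.
by apply/imsetP/imsetP => -[x _ ->]; exists x.
Qed.

(** The power of [t] gives one factor [t] to each cycle, so both sums are cycle weight sums and the
    common [n!] cancels. *)
Lemma expect_expseq n (t : C) a b :
  expseq (fun j => t * (theta R j)%:C) a ->
  expseq (fun j => (theta R j)%:C) b ->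
  expect (fun s : 'S_n => t ^+ ncycles s) = a n / b n.
Proof.
move=> /(cycle_weight_sum_expseq [set: 'I_n]) aE.
move=> /(cycle_weight_sum_expseq [set: 'I_n]) bE.
rewrite cardsT card_ord !cycle_weight_sumT in aE bE.
have nz : n`!%:R != 0 :> C by rewrite pnatr_eq0 -lt0n fact_gt0.
have -> : a n / b n = (n`!%:R * a n) / (n`!%:R * b n) by rewrite -mulf_div divff // mul1r.
rewrite -aE -bE /expect mulr_suml; apply: eq_bigr => s _.
rewrite /perm_prob rmorphM fmorphV rmorph_sum /= weightE rmorph_prod /=.
rewrite mulrAC; congr (_ / _).
  by rewrite big_split /= prodr_const mulrC.
by apply: eq_bigr => u _; rewrite weightE rmorph_prod.
Qed.

(** A permutation of a nonempty set has a cycle. This settles [t = 0], where one cannot divide by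
    the main term. *)
Lemma expect0 n : (0 < n)%N -> expect (fun s : 'S_n => (0 : C) ^+ ncycles s) = 0.
Proof.
move=> n0; rewrite /expect big1 // => s _.
rewrite expr0n; case: eqP => [h|_]; last by rewrite mulr0.
have : porbit s (Ordinal n0) \in porbits s by apply: imset_f.
by move/cards0_eq: h => ->; rewrite inE.
Qed.

End Expectation.

Import ComplexField.Normc.

(** * The modulus as a real number, and limits with an explicit rate *)

Section Modulus.
Set Implicit Arguments.
Unset Strict Implicit.
Variable R : realType.
Local Notation C := R[i].
Implicit Types (z w : C) (x : R).

Lemma normc_norm z : `|z| = (normc z)%:C.
Proof. by case: z. Qed.

Lemma normc_ge0 z : 0 <= normc z.
Proof. by case: z => a b; apply: sqrtr_ge0. Qed.

Lemma normc_gt0 z : (0 < normc z) = (z != 0).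
Proof. by rewrite -ltcR -normc_norm normr_gt0. Qed.

Lemma normc_sub_le0 z w : normc (z - w) <= 0 -> z = w.
Proof. by rewrite leNgt normc_gt0 negbK subr_eq0 => /eqP. Qed.

Lemma normcD z w : normc (z + w) <= normc z + normc w.
Proof. by rewrite -lecR rmorphD /= -!normc_norm ler_normD. Qed.

Lemma normcN z : normc (- z) = normc z.
Proof. by apply: complexI; rewrite -!normc_norm normrN. Qed.

Lemma normcB z w : normc (z - w) <= normc z + normc w.
Proof. by rewrite -[X in _ <= _ + X]normcN normcD. Qed.

Lemma normc_sub_sym z w : normc (z - w) = normc (w - z).
Proof. by rewrite -normcN opprB. Qed.

Lemma normc_real x : normc x%:C = `|x|.
Proof. by rewrite /= expr0n addr0 sqrtr_sqr. Qed.

Lemma normc_nat n : normc (n%:R : C) = n%:R.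
Proof.
have -> : n%:R = (n%:R : R)%:C by rewrite rmorph_nat.
by rewrite normc_real ger0_norm.
Qed.

Lemma normcX z n : normc (z ^+ n) = normc z ^+ n.
Proof. by elim: n => [|n IH]; rewrite ?normc1 // !exprS normcM IH. Qed.

Lemma normc_sum (I : Type) (r : seq I) (P : pred I) (F : I -> C) :
  normc (\sum_(i <- r | P i) F i) <= \sum_(i <- r | P i) normc (F i).
Proof.
elim/big_rec2: _ => [|i x z _ h]; first by rewrite normc0.
by apply: le_trans (normcD _ _) _; rewrite lerD2l.
Qed.

Lemma Re_le_normc z : `|complex.Re z| <= normc z.
Proof. by rewrite -lecR -normc_norm normc_ge_Re. Qed.

Lemma Im_le_normc z : `|complex.Im z| <= normc z.
Proof. by case: z => a b /=; rewrite -sqrtr_sqr ler_wsqrtr // lerDr sqr_ge0. Qed.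

Lemma normc_le_ReIm z : normc z <= `|complex.Re z| + `|complex.Im z|.
Proof.
case: z => a b /=; rewrite -[leRHS]ger0_norm ?addr_ge0 // -[leRHS]sqrtr_sqr.
rewrite ler_wsqrtr //.
by rewrite sqrrD !real_normK ?num_real // lerD2r lerDl mulrn_wge0 // mulr_ge0.
Qed.

(** [u n - c / n] is nondecreasing and [u n + c / n] nonincreasing, so the supremum of the former
    lies between the two. *)
Lemma real_telescoping_limit (u : nat -> R) (c : R) :
  (forall n, (0 < n)%N -> `|u n.+1 - u n| <= c * (n%:R^-1 - n.+1%:R^-1)) ->
  exists l, forall n, (0 < n)%N -> `|l - u n| <= c / n%:R.
Proof.
move=> uc.
have lo m k : (0 < m)%N -> u m - c / m%:R <= u (m + k)%N - c / (m + k)%:R.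
  move=> m0; elim: k => [|k IH]; first by rewrite addn0.
  rewrite addnS; apply: le_trans IH _.
  have := uc (m + k)%N; rewrite addn_gt0 m0 ler_norml => /(_ isT) /andP[h _].
  by move: h; rewrite mulrBr; move: (c / _) (c / _) => p q; lra.
have hi m k : (0 < m)%N -> u (m + k)%N + c / (m + k)%:R <= u m + c / m%:R.
  move=> m0; elim: k => [|k IH]; first by rewrite addn0.
  rewrite addnS; apply: le_trans IH.
  have := uc (m + k)%N; rewrite addn_gt0 m0 ler_norml => /(_ isT) /andP[_ h].
  by move: h; rewrite mulrBr; move: (c / _) (c / _) => p q; lra.
have c0 : 0 <= c.
  have := uc 1%N isT; have : 0 < (1%:R^-1 - 2%:R^-1 : R) by lra.
  by move=> h /(le_trans (normr_ge0 _)); rewrite pmulr_lge0.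
have cn n : 0 <= c / n%:R by rewrite divr_ge0.
have lohi m n : (0 < m)%N -> (0 < n)%N -> u m - c / m%:R <= u n + c / n%:R.
  move=> m0 n0; apply: le_trans (lo m n m0) _.
  apply: le_trans (hi n m n0); rewrite addnC.
  by have := cn (n + m)%N; lra.
pose E := [set u m - c / m%:R | m in [set m | (0 < m)%N]].
exists (sup E) => n n0.
rewrite ler_norml; apply/andP; split.
  rewrite lerBrDr addrC; apply: ub_le_sup; last by exists n.
  by exists (u 1%N + c / 1%:R) => _ [m /= m0 <-]; exact: lohi.
rewrite lerBlDr addrC; apply: ge_sup; first by exists (u n - c / n%:R); exists n.
by move=> _ [m /= m0 <-]; exact: lohi.
Qed.

Lemma telescoping_limit (v : nat -> C) (c : R) :
  (forall n, (0 < n)%N -> normc (v n.+1 - v n) <= c * (n%:R^-1 - n.+1%:R^-1)) ->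
  exists l, forall n, (0 < n)%N -> normc (l - v n) <= 2 * c / n%:R.
Proof.
move=> vc.
have [|a ha] := @real_telescoping_limit (fun n => complex.Re (v n)) c.
  by move=> n n0; apply: le_trans (vc n n0); rewrite /= -raddfB Re_le_normc.
have [|b hb] := @real_telescoping_limit (fun n => complex.Im (v n)) c.
  by move=> n n0; apply: le_trans (vc n n0); rewrite /= -raddfB Im_le_normc.
exists (a +i* b) => n n0; apply: le_trans (normc_le_ReIm _) _.
rewrite !raddfB /=.
by have := ha n n0; have := hb n n0; rewrite /=; lra.
Qed.

Lemma limn_rate (v : nat -> C) l (c : R) :
  (forall n, (0 < n)%N -> normc (l - v n) <= c / n%:R) -> limn v = l.
Proof.
move=> h; apply: cvg_lim; first exact: norm_hausdorff.
apply/cvgrPdist_lt => e e0.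
(* The radius is a complex number; being positive, it is real. *)
have [a ea] : exists a : R, e = a%:C.
  by apply/complex_realP; rewrite gtr0_real.
move: e0; rewrite ea ltcR => a0.
have c0 : 0 <= c by have := le_trans (normc_ge0 _) (h 1%N isT); rewrite divr1.
near=> n; rewrite normc_norm ltcR; apply: le_lt_trans (h n _) _.
  by near: n; exact: nbhs_infty_gt.
rewrite ltr_pdivrMr; last by rewrite ltr0n; near: n; exact: nbhs_infty_gt.
rewrite mulrC -ltr_pdivrMr //; near: n; exact: nbhs_infty_gtr.
Unshelve. all: by end_near. Qed.

Lemma real_limn_rate (v : nat -> R) l (c : R) :
  (forall n, (0 < n)%N -> `|l - v n| <= c / n%:R) -> limn v = l.
Proof.
move=> h; apply: cvg_lim => //; apply/cvgrPdist_lt => e e0.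
near=> n; apply: le_lt_trans (h n _) _.
  by near: n; exact: nbhs_infty_gt.
rewrite ltr_pdivrMr; last by rewrite ltr0n; near: n; exact: nbhs_infty_gt.
rewrite mulrC -ltr_pdivrMr //; near: n; exact: nbhs_infty_gtr.
Unshelve. all: by end_near. Qed.

(** This is how inequalities pass to the limit: bounds valid up to [c / n] for every [n] hold
    exactly. *)
Lemma le0_rate x (c : R) :
  (forall n, (0 < n)%N -> x <= c / n%:R) -> x <= 0.
Proof.
move=> h; rewrite leNgt; apply/negP => x0.
have := archi_boundP (divr_ge0 (normr_ge0 c) (ltW x0)).
set n := Num.bound _ => hn.
have n0 : (0 < n)%N by rewrite lt0n; apply/eqP => n0; move: hn; rewrite n0 ltNge divr_ge0 ?ltW.
have := h n n0; rewrite ler_pdivlMr ?ltr0n //.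
move: hn; rewrite ltr_pdivrMr // mulrC => hn /(lt_le_trans hn).
by rewrite ltNge ler_norm.
Qed.

End Modulus.

(** * The complex exponential and its Taylor remainders *)

Section ComplexExponential.
Set Implicit Arguments.
Unset Strict Implicit.
Variable R : realType.
Local Notation C := R[i].
Implicit Types (z w : C) (x b : R).

Lemma sin_le_norm b : `|sin b| <= `|b|.
Proof.
wlog b0 : b / 0 < b => [h|].
  have [bn|/h//|->] := ltgtP b 0; last by rewrite sin0.
  by rewrite -normrN -sinN -[leRHS]normrN; apply: h; rewrite oppr_gt0.
have [|c _] := @MVT R (@sin R) (@cos R) 0 b b0 (fun x _ => is_derive_sin x).
  by apply: continuous_subspaceT => x; exact: continuous_sin.
rewrite sin0 !subr0 => ->; rewrite normrM ler_piMl //.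
exact: cos_max.
Qed.

Lemma cos_half b : cos b - 1 = - (2 * sin (b / 2) ^+ 2).
Proof.
have {1}-> : b = (b / 2) *+ 2 by rewrite mulr2n; lra.
by rewrite cos_mulr2n cos2sin2 mulr2n; ring.
Qed.

Lemma cos_sub1_le b : `|cos b - 1| <= `|b|.
Proof.
rewrite cos_half normrN normrM normrX ger0_norm //.
have h1 := sin_le_norm (b / 2); have h2 := sin_max (b / 2).
rewrite normrM in h1; have -> : `|b| = 2 * (`|b| * `|2^-1|).
  by rewrite [`|2^-1|]ger0_norm; lra.
have := normr_ge0 (sin (b / 2)); nra.
Qed.

Lemma cos_sub1_le_sqr b : `|cos b - 1| <= b ^+ 2 / 2.
Proof.
rewrite cos_half normrN normrM normrX ger0_norm //.
have h1 := sin_le_norm (b / 2).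
rewrite normrM [`|2^-1|]ger0_norm ?invr_ge0 // in h1.
have -> : b ^+ 2 = `|b| ^+ 2 by rewrite real_normK ?num_real.
by have := normr_ge0 (sin (b / 2)); nra.
Qed.

Lemma sin_sub_le_sqr b : `|sin b - b| <= b ^+ 2.
Proof.
wlog b0 : b / 0 < b => [h|].
  have [bn|/h//|->] := ltgtP b 0; last by rewrite sin0 subrr normr0 expr0n.
  have -> : sin b - b = - (sin (- b) - - b) by rewrite sinN; ring.
  by rewrite normrN -sqrrN h // oppr_gt0.
have [|c] := @MVT R (@sin R) (@cos R) 0 b b0 (fun x _ => is_derive_sin x).
  by apply: continuous_subspaceT => x; exact: continuous_sin.
rewrite in_itv /= => /andP[c0 cb]; rewrite sin0 !subr0 => ->.
rewrite -{2}[b]mul1r -mulrBl normrM expr2 (gtr0_norm b0) ler_wpM2r ?(ltW b0) //.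
by apply: le_trans (cos_sub1_le _) _; rewrite gtr0_norm // ltW.
Qed.

Lemma expR_sub1_le x : `|expR x - 1| <= `|x| * expR `|x|.
Proof.
have [x0|x0] := leP 0 x.
  rewrite !ger0_norm ?subr_ge0 -?expR0 ?ler_expR // expR0.
  have := expR_ge1Dx (- x); rewrite expRN => h.
  have := expR_gt0 x => e0; have : expR x * (1 - x) <= 1.
    by rewrite -ler_pdivlMl // mulr1; lra.
  lra.
rewrite !ltr0_norm // ?subr_lt0 ?expR_lt1 // opprB.
have := expR_ge1Dx x => h; have : 1 <= expR (- x).
  by rewrite -expR0 ler_expR; lra.
by nra.
Qed.

Lemma expR_sub1x_le x : `|expR x - 1 - x| <= x ^+ 2 * expR `|x|.
Proof.
have -> : x ^+ 2 = `|x| ^+ 2 by rewrite real_normK ?num_real.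
have lo := expR_ge1Dx x; rewrite ger0_norm; last by lra.
have e0 := expR_gt0 x; have := expR_ge1Dx (- x); rewrite expRN => h.
have h' : expR x * (1 - x) <= 1.
  by rewrite -ler_pdivlMl // mulr1; lra.
have [x0|x0] := leP 0 x; first by rewrite ger0_norm //; nra.
rewrite ltr0_norm //; have : 1 <= expR (- x) by rewrite -expR0 ler_expR; lra.
by nra.
Qed.

Definition cexp z : C :=
  (expR (complex.Re z))%:C * (cos (complex.Im z) +i* sin (complex.Im z)).

Lemma cpowE x z : cpow x z = cexp (z * (ln x)%:C).
Proof.
by case: z => a b; rewrite /cpow /cexp /= !mulr0 subr0 add0r [_ * ln x]mulrC.
Qed.

Lemma cexpD z w : cexp (z + w) = cexp z * cexp w.
Proof.
case: z w => [a b] [c d]; rewrite /cexp /= expRD cosD sinD.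
apply/eqP; rewrite eq_complex /=; apply/andP; split; apply/eqP; ring.
Qed.

Lemma cexp_real x : cexp x%:C = (expR x)%:C.
Proof. by rewrite /cexp /= cos0 sin0 mulr1. Qed.

Lemma cexp0 : cexp 0 = 1.
Proof. by rewrite (cexp_real 0) expR0. Qed.

Lemma cexpNK z : cexp z * cexp (- z) = 1.
Proof. by rewrite -cexpD subrr cexp0. Qed.

Lemma cexp_neq0 z : cexp z != 0.
Proof.
by apply/eqP => h; have := cexpNK z; rewrite h mul0r => /eqP; rewrite eq_sym oner_eq0.
Qed.

Lemma normc_cexp z : normc (cexp z) = expR (complex.Re z).
Proof.
rewrite normcM normc_real ger0_norm ?expR_ge0 //=.
by rewrite cos2Dsin2 sqrtr1 mulr1.
Qed.

Lemma normc_cexp_le z : normc (cexp z) <= expR (normc z).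
Proof.
rewrite normc_cexp ler_expR.
by apply: (le_trans (ler_norm _)); exact: Re_le_normc.
Qed.

(** Second-order remainders of [expR], [cos] and [sin] are combined in the real and imaginary parts;
    3 is a convenient constant, not a sharp one. *)
Lemma cexp_sub1z_le z : normc (cexp z - 1 - z) <= 3 * normc z ^+ 2 * expR (normc z).
Proof.
case: z => a b; set m := normc (a +i* b).
have am : `|a| <= m := Re_le_normc (a +i* b).
have bm : `|b| <= m := Im_le_normc (a +i* b).
apply: le_trans (normc_le_ReIm _) _; rewrite /cexp /=.
rewrite !mul0r !subr0 addr0.
have -> : expR a * cos b - 1 - a = (expR a - 1 - a) + expR a * (cos b - 1) by ring.
have -> : expR a * sin b - b = (sin b - b) + (expR a - 1) * sin b by ring.
have ea : expR a <= expR m by rewrite ler_expR (le_trans (ler_norm a)).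
have ea' : expR `|a| <= expR m by rewrite ler_expR.
have e1 : 1 <= expR m by rewrite -expR0 ler_expR normc_ge0.
have a2 : a ^+ 2 + b ^+ 2 = m ^+ 2 by rewrite /m /= sqr_sqrtr ?addr_ge0 ?sqr_ge0.
have t1 : `|expR a - 1 - a| <= a ^+ 2 * expR m.
  by apply: le_trans (expR_sub1x_le _) _; rewrite ler_wpM2l ?sqr_ge0.
have t2 : `|expR a * (cos b - 1)| <= expR m * (b ^+ 2 / 2).
  by rewrite normrM ler_pM ?cos_sub1_le_sqr // ger0_norm ?expR_ge0.
have t3 : `|sin b - b| <= b ^+ 2 * expR m.
  by apply: le_trans (sin_sub_le_sqr _) _; rewrite ler_peMr ?sqr_ge0.
have t4 : `|(expR a - 1) * sin b| <= (`|a| * expR m) * `|b|.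
  rewrite normrM ler_pM ?sin_le_norm //.
  by apply: le_trans (expR_sub1_le _) _; rewrite ler_wpM2l.
have t5 : `|a| * `|b| <= m ^+ 2 / 2.
  rewrite -a2 -(real_normK (num_real a)) -(real_normK (num_real b)).
  have := sqr_ge0 (`|a| - `|b|); nra.
have n1 := ler_normD (expR a - 1 - a) (expR a * (cos b - 1)).
have n2 := ler_normD (sin b - b) ((expR a - 1) * sin b).
have b2 := sqr_ge0 b; have a2' := sqr_ge0 a.
have t6 : `|a| * expR m * `|b| <= m ^+ 2 / 2 * expR m.
  by rewrite mulrAC ler_wpM2r // expR_ge0.
rewrite -a2 in t6 *; nra.
Qed.

Lemma cexp_sub1_le z : normc (cexp z - 1) <= normc z * 4 * expR (2 * normc z).
Proof.
have -> : cexp z - 1 = (cexp z - 1 - z) + z by ring.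
have := normcD (cexp z - 1 - z) z; have := cexp_sub1z_le z.
move: (normc (_ - _ - z)) (normc (_ - _ - z + z)) => p q.
have m0 := normc_ge0 z; move: (normc z) m0 => m m0 h1 h2.
apply: le_trans h2 _.
have e1 := expR_ge1Dx m; have -> : expR (2 * m) = expR m * expR m.
  by rewrite -expRD; congr expR; ring.
move: (expR m) h1 e1 => e h1 e1.
have e2 : 0 <= m * e * (e - (1 + m)) by rewrite !mulr_ge0 ?subr_ge0 //; lra.
have e3 : 0 <= m * (e * e - 1) by rewrite mulr_ge0 //; nra.
have e4 : 0 <= m * e by rewrite mulr_ge0 //; lra.
by nra.
Qed.

End ComplexExponential.

(** * Bounds for [zeta (2j) - 1] *)

Section ZetaTail.
Set Implicit Arguments.
Unset Strict Implicit.
Variable R : realType.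
Implicit Types (j k m n M : nat).

Definition zeta_tail j : R := zeta (2 * j)%:R - 1.

Definition zeta_tail_part M j : R := \sum_(m < M) (m.+2%:R ^+ (2 * j))^-1.

Lemma inv_sqr_telescope m : (0 < m)%N ->
  (m.+1%:R ^+ 2)^-1 <= m%:R^-1 - m.+1%:R^-1 :> R.
Proof.
move=> m0; have m0' : 0 < m%:R :> R by rewrite ltr0n.
rewrite -natr1; move: m%:R m0' => x x0.
have -> : x^-1 - (x + 1)^-1 = (x * (x + 1))^-1.
  by field; rewrite !lt0r_neq0 //; lra.
by rewrite lef_pV2 ?posrE; nra.
Qed.

Lemma div4_exp4S j : 4 / 4 ^+ j.+1 = (4 ^+ j)^-1 :> R.
Proof. by rewrite exprS invfM mulrA divff ?mul1r // pnatr_eq0. Qed.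

(** As [m + 1 >= 2], all but two of the [2j] factors give [4^-(j-1)]; the remaining inverse square
    telescopes in [m]. *)
Lemma inv_pow_le m j : (0 < m)%N -> (0 < j)%N ->
  (m.+1%:R ^+ (2 * j))^-1 <= 4 / 4 ^+ j * (m%:R^-1 - m.+1%:R^-1) :> R.
Proof.
case: j => // j m0 _; apply: le_trans (_ : (4 ^+ j)^-1 * (m.+1%:R ^+ 2)^-1 <= _).
  rewrite -invfM lef_pV2 ?posrE ?mulr_gt0 ?exprn_gt0 ?ltr0n //.
  rewrite exprM [leRHS]exprS mulrC ler_wpM2l ?exprn_ge0 //.
  apply: lerXn2r; rewrite ?nnegrE ?exprn_ge0 //.
  by have : 2 <= m.+1%:R :> R by [rewrite ler_nat]; nra.
by rewrite div4_exp4S ler_wpM2l ?invr_ge0 ?exprn_ge0 // inv_sqr_telescope.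
Qed.

Lemma zeta_tail_part_mono M k j : zeta_tail_part M j <= zeta_tail_part (M + k) j.
Proof.
by rewrite /zeta_tail_part big_split_ord /= lerDl sumr_ge0.
Qed.

Lemma zeta_tail_part_le M k j : (0 < j)%N ->
  zeta_tail_part (M + k) j <=
    zeta_tail_part M j + 4 / 4 ^+ j * (M.+1%:R^-1 - (M + k).+1%:R^-1).
Proof.
move=> j0; elim: k => [|k IH]; first by rewrite addn0 subrr mulr0 addr0.
rewrite addnS [leLHS]big_ord_recr /= -/(zeta_tail_part _ _).
have := @inv_pow_le (M + k).+1 j isT j0; move: IH.
rewrite !mulrBr; move: (_ / M.+1%:R) (_ / (M + k).+1%:R) (_ / (M + k).+2%:R).
by move=> p q r; lra.
Qed.

(** This ties the limit defining [zeta] to its partial sums; the rate is what [le0_rate]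
    consumes. *)
Lemma zeta_tailP j : (0 < j)%N ->
  forall n, `|zeta_tail j - zeta_tail_part n j| <= n.+1%:R^-1.
Proof.
move=> j0; pose u n : R := series (fun m : nat => m.+1%:R `^ (- (2 * j)%:R)) n.
have uS n : u n.+1 = 1 + zeta_tail_part n j.
  rewrite /u /series /= big_nat_recl // powR1; congr (_ + _).
  rewrite big_mkord; apply: eq_bigr => i _.
  by rewrite powR_invn.
have [|l hl] := @real_telescoping_limit R u 1.
  move=> [//|n] _; rewrite !uS [zeta_tail_part n.+1 j]big_ord_recr /=.
  rewrite -/(zeta_tail_part n j) opprD addrACA subrr add0r addrAC subrr add0r.
  rewrite mul1r ger0_norm ?invr_ge0 ?exprn_ge0 //.
  apply: le_trans (inv_pow_le _ j0) _ => //.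
  rewrite ler_piMl ?subr_ge0 ?lef_pV2 ?posrE ?ltr0n ?ler_nat //.
  case: (j) j0 => // i _; rewrite div4_exp4S.
  by rewrite invf_le1 ?exprn_gt0 // exprn_ege1 // ler1n.
have zl : zeta (2 * j)%:R = l by exact: (@real_limn_rate R u l 1).
move=> n; have := hl n.+1 isT; rewrite uS -zl mul1r /zeta_tail.
by rewrite opprD addrA.
Qed.

(** [M = 0] gives the decay in [4^-j]; for large [M], the factor [1 / (M + 1)] lets the sums over
    [m] and [j] be exchanged in [log_value_zeta_tail]. *)
Lemma zeta_tail_bounds M j : (0 < j)%N ->
  zeta_tail_part M j <= zeta_tail j <=
    zeta_tail_part M j + 4 / 4 ^+ j / M.+1%:R.
Proof.
move=> j0; apply/andP; split; rewrite -subr_le0; apply: (@le0_rate R _ 1) => n n0;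
  have := zeta_tailP j0 (M + n); rewrite ler_norml => /andP[h1 h2];
  have : (M + n).+1%:R^-1 <= 1 / n%:R :> R
   by [rewrite mul1r lef_pV2 ?posrE ?ltr0n // ler_nat -addnS -addSnnS leq_addl].
  have := zeta_tail_part_mono M n j; move: (1 / n%:R) (_^-1) h1 h2 => p q; lra.
have := zeta_tail_part_le M n j0; rewrite mulrBr.
have : 0 <= 4 / 4 ^+ j / (M + n).+1%:R :> R by rewrite !divr_ge0 ?exprn_ge0.
move: (4 / 4 ^+ j / M.+1%:R) (4 / 4 ^+ j / (M + n).+1%:R) => a b.
by move: (1 / n%:R) (_^-1) h1 h2 => p q; lra.
Qed.

Lemma zeta_tail_pow4_bounded j : (0 < j)%N -> 0 <= zeta_tail j <= 4 / 4 ^+ j.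
Proof.
by move/(@zeta_tail_bounds 0%N); rewrite /zeta_tail_part big_ord0 divr1 add0r.
Qed.

End ZetaTail.

(** * Geometrically decaying sequences and their sums *)

Section GeometricSequences.
Set Implicit Arguments.
Unset Strict Implicit.
Variable R : realType.
Local Notation C := R[i].
Implicit Types (e p : nat -> R) (a b : nat -> C) (s : C) (D : R) (j k m n : nat).

Lemma pow_le_exp2 m : exists2 K : R, 0 < K & forall k, k.+1%:R ^+ m <= K * 2 ^+ k.
Proof.
case: m => [|m]; first by exists 1 => // k; rewrite mul1r expr0 exprn_ege1 // ler1n.
have l2 : 0 < ln 2 :> R by rewrite ln_gt0 // ltr1n.
(* Chosen so that [exp (k c) ^ (m+1) = 2^k]; as [c <= 1], [c (k+1) <= 1 + k c <= exp (k c)]. *)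
pose c : R := ln 2 / m.+1%:R.
have c0 : 0 < c by rewrite divr_gt0.
have c1 : c <= 1.
  rewrite ler_pdivrMr // mul1r; apply: le_trans (_ : 1 <= _); last by rewrite ler1n.
  by have := @le_ln1Dx R 1; rewrite -natr1; apply; lra.
exists ((c ^+ m.+1)^-1) => [|k]; first by rewrite invr_gt0 exprn_gt0.
rewrite mulrC ler_pdivlMr ?exprn_gt0 // -exprMn.
have -> : 2 ^+ k = expR (k%:R * c) ^+ m.+1 :> R.
  rewrite -expRM_natl mulrCA /c [_ * (_ / _)]mulrC divfK ?pnatr_eq0 //.
  by rewrite expRM_natl lnK ?posrE.
have kc : 0 <= k%:R * c by rewrite mulr_ge0 ?(ltW c0).
apply: lerXn2r; rewrite ?nnegrE.
- by rewrite mulr_ge0 ?(ltW c0).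
- exact: expR_ge0.
apply: (le_trans _ (expR_ge1Dx _)); rewrite -natr1 mulrDl mul1r addrC.
by rewrite lerD2r.
Qed.

(** Geometric decay in the form required by the telescoping limits; it amounts to
    [n (n+1) <= 4 * 2^n]. *)
Lemma inv_exp2_le_telescope n : (0 < n)%N ->
  (2 ^+ n)^-1 <= 4 * (n%:R^-1 - n.+1%:R^-1) :> R.
Proof.
move=> n0; have n0' : 0 < n%:R :> R by rewrite ltr0n.
have -> : n%:R^-1 - n.+1%:R^-1 = (n * n.+1)%:R^-1 :> R.
  by rewrite natrM -natr1; field; rewrite !lt0r_neq0 //; lra.
rewrite ler_pdivlMr ?ltr0n ?muln_gt0 ?n0 //.
rewrite -ler_pdivlMl ?invr_gt0 ?exprn_gt0 // invrK.
rewrite mulrC -natrX -natrM ler_nat.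
case: n {n0 n0'} => // -[|[|n]] //; elim: n => // n IH.
by rewrite expnS; move: IH; move: (2 ^ _)%N => x; nia.
Qed.

Lemma sum_inv_exp2_le n : \sum_(k < n) (2 ^+ k)^-1 <= 2 - 2 / 2 ^+ n :> R.
Proof.
elim: n => [|n IH]; first by rewrite big_ord0 expr0 divr1 subrr.
rewrite big_ord_recr /= exprS invfM; move: IH; move: (_^-1) => x.
lra.
Qed.

Definition pow4_bounded e := forall j, (0 < j)%N -> 0 <= e j <= 4 / 4 ^+ j.

Definition pow2_bounded D a := forall k, normc (a k) <= D / 2 ^+ k.

(** Split [4^-j] as [2^-j * 2^-j]: one factor completes [2^-(n-j)] to [2^-n], the other sums to at
    most 2. *)
Lemma pow4_conv_le e p P n : pow4_bounded e -> 0 <= P ->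
  (forall i, (i <= n)%N -> p i <= P / 2 ^+ i) ->
  \sum_(j < n.+1) e j.+1 * p (n - j)%N <= 2 * P / 2 ^+ n.
Proof.
move=> ge P0 pP.
apply: le_trans (_ : \sum_(j < n.+1) P / 2 ^+ n * (2 ^+ j)^-1 <= _).
  apply: ler_sum => j _; have /andP[e0 e1] := ge j.+1 isT.
  apply: le_trans (ler_wpM2l e0 (pP _ (leq_subr _ _))) _.
  apply: le_trans (ler_wpM2r _ e1) _; first by rewrite divr_ge0 ?exprn_ge0.
  rewrite div4_exp4S.
  have jn : (j <= n)%N by rewrite -ltnS.
  have -> : 2 ^+ n = 2 ^+ (n - j) * 2 ^+ j :> R by rewrite -exprD subnK.
  rewrite invfM.
  have -> : (4 : R) = 2 * 2 by ring.
  rewrite exprMn invfM; move: (2 ^- j) (2 ^- (n - j)) => x y.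
  by rewrite le_eqVlt; apply/orP; left; apply/eqP; ring.
rewrite -mulr_sumr [2 * P]mulrC [leRHS]mulrAC ler_wpM2l ?divr_ge0 ?exprn_ge0 //.
apply: le_trans (sum_inv_exp2_le _) _.
by rewrite lerBlDr lerDl divr_ge0 ?exprn_ge0.
Qed.

Lemma expseq_norm_le e s a n : pow4_bounded e -> expseq (fun j => s * (e j)%:C) a ->
  n.+1%:R * normc (a n.+1) <= normc s * \sum_(j < n.+1) e j.+1 * normc (a (n - j)%N).
Proof.
move=> ge [_ aS]; rewrite -normc_nat -normcM aS mulr_sumr.
apply: le_trans (normc_sum _ _ _) _; apply: ler_sum => j _.
rewrite !normcM normc_real ger0_norm ?mulrA //.
by have /andP[] := ge j.+1 isT.
Qed.

Lemma expseq_pow2_bounded e s a (B : nat) : pow4_bounded e ->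
  expseq (fun j => s * (e j)%:C) a -> (0 < B)%N -> normc s <= B%:R ->
  pow2_bounded ((4 * B)%:R ^+ (4 * B)) a.
Proof.
move=> ge aP B0 sB; set L := (4 * B)%N.
have L1 : 1 <= L%:R :> R by rewrite ler1n muln_gt0.
(* The recursion costs a factor [L / (k+1)] per step. While [k < L] the factor [L] is paid in full;
   afterwards [k + 1] absorbs it, so the bound stops growing. *)
pose P k : R := L%:R ^+ minn k L.
have P0 k : 0 <= P k by rewrite exprn_ge0.
have Pm i k : (i <= k)%N -> P i <= P k.
  by move=> ik; rewrite ler_weXn2l // leq_min geq_minr (leq_trans (geq_minl _ _)).
suff aK k : normc (a k) <= P k / 2 ^+ k.
  move=> k; apply: le_trans (aK k) _; rewrite ler_wpM2r ?invr_ge0 ?exprn_ge0 //.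
  by rewrite ler_weXn2l // geq_minr.
elim/ltn_ind: k => -[|k] IH.
  by case: (aP) => -> _; rewrite normc1 /P min0n !expr0 divr1.
rewrite -(@ler_pM2l _ k.+1%:R) ?ltr0n //.
apply: le_trans (expseq_norm_le _ ge aP) _.
have aP' i : (i <= k)%N -> normc (a i) <= P k / 2 ^+ i.
  move=> ik; apply: le_trans (IH i _) _; first by rewrite ltnS.
  by rewrite ler_wpM2r ?invr_ge0 ?exprn_ge0 // Pm.
apply: le_trans (ler_wpM2l (normc_ge0 _) (pow4_conv_le ge (P0 k) aP')) _.
apply: le_trans (ler_wpM2r _ sB) _; first by rewrite divr_ge0 ?mulr_ge0 ?exprn_ge0.
have -> : B%:R * (2 * P k / 2 ^+ k) = L%:R * P k / 2 ^+ k.+1.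
  by rewrite exprS /L natrM; field; rewrite expf_neq0.
rewrite [leRHS]mulrA ler_wpM2r ?invr_ge0 ?exprn_ge0 //.
have [kL|kL] := ltnP k L.
  have -> : L%:R * P k = P k.+1.
    by rewrite -exprS /P -minnSS; congr (_ ^+ _); lia.
  by rewrite ler_peMl // ler1n.
have -> : P k = P k.+1 by rewrite /P; congr (_ ^+ _); lia.
by rewrite ler_wpM2r // ler_nat ltnW.
Qed.

Lemma expseq_le_linear e s a D n : pow4_bounded e -> pow2_bounded D a ->
  expseq (fun j => s * (e j)%:C) a -> (0 < n)%N ->
  n%:R * normc (a n) <= normc s * (4 * D / 2 ^+ n).
Proof.
move=> ge aD aP; case: n => // n _.
apply: le_trans (expseq_norm_le _ ge aP) _; rewrite ler_wpM2l ?normc_ge0 //.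
have D0 : 0 <= D.
  by have := le_trans (normc_ge0 _) (aD 0%N); rewrite expr0 divr1.
apply: le_trans (pow4_conv_le ge D0 (fun i _ => aD i)) _.
rewrite exprS invfM; have := invr_ge0 (2 ^+ n : R); rewrite exprn_ge0 //.
by move: (_^-1) => x x0; nra.
Qed.

(** [s e_n / n] is the part of [a_n] linear in [s]. Feeding the bound of [expseq_le_linear], already
    proportional to [s], into the recursion yields the second factor [s]. *)
Lemma expseq_sub_linear_le e s a D n : pow4_bounded e -> pow2_bounded D a ->
  expseq (fun j => s * (e j)%:C) a -> (0 < n)%N ->
  normc (a n - s * (e n / n%:R)%:C) <= 16 * D * normc s ^+ 2 / 2 ^+ n.
Proof.
move=> ge aD aP; case: n => // n _; case: (aP) => a0 aS.
have nz : n.+1%:R != 0 :> C by rewrite pnatr_eq0.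
have D0 : 0 <= D.
  by have := le_trans (normc_ge0 _) (aD 0%N); rewrite expr0 divr1.
have -> : a n.+1 - s * (e n.+1 / n.+1%:R)%:C =
    n.+1%:R^-1 * \sum_(j < n) s * (e j.+1)%:C * a (n - j)%N.
  apply: (mulfI nz); rewrite mulrA divff // mul1r mulrBr aS big_ord_recr /=.
  rewrite subnn a0 mulr1 rmorphM fmorphV rmorph_nat /=.
  rewrite [s * _ in X in _ - X]mulrA [_ * (_ / _)]mulrC divfK //.
  by rewrite addrK.
rewrite normcM normcV normc_nat.
rewrite -ler_pdivlMl ?invr_gt0 ?ltr0n // invrK.
apply: le_trans (normc_sum _ _ _) _.
(* The value 0 at index 0 removes the term with [a_0 = 1], which is the linear part. *)
pose p i := if i is 0 then 0 else normc (a i).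
have s0 := normc_ge0 s.
apply: le_trans (_ : normc s * (2 * (4 * D * normc s) / 2 ^+ n) <= _).
  have pP i : (i <= n)%N -> p i <= 4 * D * normc s / 2 ^+ i.
    case: i => [|i] _; first by rewrite expr0 divr1 !mulr_ge0.
    have := expseq_le_linear ge aD aP (ltn0Sn i); rewrite /p => h.
    apply: le_trans (_ : i.+1%:R * normc (a i.+1) <= _).
      by rewrite ler_peMl ?normc_ge0 // ler1n.
    by apply: le_trans h _; rewrite le_eqVlt; apply/orP; left; apply/eqP; ring.
  have P0 : 0 <= 4 * D * normc s by rewrite !mulr_ge0.
  have := ler_wpM2l s0 (pow4_conv_le ge P0 pP).
  apply: le_trans; rewrite big_ord_recr /= subnn mulr0 addr0 mulr_sumr.
  apply: ler_sum => j _; rewrite !normcM normc_real ger0_norm; last first.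
    by have /andP[] := ge j.+1 isT.
  by have := ltn_ord j; rewrite -subn_gt0 -mulrA; case: (n - j)%N.
have x0 : 0 <= (2 ^+ n)^-1 :> R by rewrite invr_ge0 exprn_ge0.
have n1 : 1 <= n.+1%:R :> R by rewrite ler1n.
have w0 : 0 <= 8 * D * normc s ^+ 2 * (2 ^+ n)^-1 by rewrite !mulr_ge0 ?sqr_ge0.
by rewrite [2 ^+ n.+1]exprS invfM; move: (2 ^- n) x0 w0 => x x0 w0; nra.
Qed.

(** For the coefficients of [F_s] this is [F_s(1)]. *)
Definition gsum a : C := limn (fun n => \sum_(k < n) a k).

Lemma gsum_rate D a n : pow2_bounded D a -> (0 < n)%N ->
  normc (gsum a - \sum_(k < n) a k) <= 8 * D / n%:R.
Proof.
move=> aD n0.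
have [|l hl] := @telescoping_limit R (fun n => \sum_(k < n) a k) (4 * D).
  move=> m m0; rewrite big_ord_recr /= addrAC subrr add0r.
  apply: le_trans (aD m) _; rewrite [4 * D]mulrC -mulrA ler_wpM2l //.
    by have := le_trans (normc_ge0 _) (aD 0%N); rewrite expr0 divr1.
  exact: inv_exp2_le_telescope.
have -> : gsum a = l by exact: limn_rate hl.
by have := hl n n0; rewrite !mulrA -natrM.
Qed.

Lemma sum_conv a b n :
  \sum_(k < n) seq_conv a b k = \sum_(i < n) a i * \sum_(m < n - i) b m.
Proof.
elim: n => [|n IH]; first by rewrite !big_ord0.
rewrite big_ord_recr /= IH /seq_conv.
have -> : \sum_(i < n) a i * (\sum_(m < n - i) b m) =
    \sum_(i < n.+1) a i * (\sum_(m < n - i) b m).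
  by rewrite big_ord_recr /= subnn big_ord0 mulr0 addr0.
rewrite -big_split /=; apply: eq_bigr => i _.
by rewrite -mulrDr (subSn (ltn_ord i : (i <= n)%N)) big_ord_recr.
Qed.

(* Allows to trade the decay in [1 / (n - k)] for a decay in [1 / n]. *)
Lemma leq_mul_sub n k : (k < n)%N -> (n <= (n - k) * k.+1)%N.
Proof. by move=> kn; rewrite -{1}(subnK (ltnW kn)); have : (0 < n - k)%N; nia. Qed.

Lemma inv_sub_le n k : (k < n)%N -> (n - k)%:R^-1 <= k.+1%:R / n%:R :> R.
Proof.
move=> kn; have n0 : (0 < n)%N by apply: leq_ltn_trans kn.
rewrite ler_pdivlMr ?ltr0n // ler_pdivrMl ?ltr0n ?subn_gt0 //.
by rewrite -natrM ler_nat leq_mul_sub.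
Qed.

Lemma pow2_bounded_sum_pow D m : exists2 K : R, 0 <= K &
  forall a n, pow2_bounded D a -> \sum_(k < n) normc (a k) * k.+1%:R ^+ m <= K.
Proof.
(* Two powers more than needed leave the summable [1 / (k+1)^2], whose sum is at most 2. *)
have [K K0 hK] := pow_le_exp2 m.+2.
exists (2 * `|D| * K) => [|a n aD]; first by rewrite !mulr_ge0 // ltW.
apply: le_trans (_ : \sum_(k < n) `|D| * K * (k.+1%:R ^+ 2)^-1 <= _).
  apply: ler_sum => k _.
  rewrite -(@ler_pM2r _ (k.+1%:R ^+ 2)) ?exprn_gt0 ?ltr0n //.
  rewrite divfK ?expf_neq0 ?pnatr_eq0 // -mulrA -exprD addn2.
  apply: le_trans (ler_pM (normc_ge0 _) _ (aD k) (hK k)) _ => //.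
  rewrite mulrA [_ * 2 ^+ k]mulrC mulrA mulrCA divff ?expf_neq0 // mulr1.
  by rewrite ler_wpM2r ?(ltW K0) // ler_norm.
rewrite -mulr_sumr -[leRHS]mulrA [leRHS]mulrC ler_wpM2l //.
  by rewrite mulr_ge0 ?(ltW K0).
case: n {aD} => [|n]; first by rewrite big_ord0.
suff : \sum_(k < n.+1) (k.+1%:R ^+ 2)^-1 <= 2 - n.+1%:R^-1 :> R.
  by move=> h; apply: le_trans h _; rewrite gerBl invr_ge0.
elim: n => [|n IH]; first by rewrite big_ord1 /= expr1n !invr1; lra.
rewrite big_ord_recr /=; have := @inv_sqr_telescope R n.+1 isT; move: IH.
by move: (\sum_(k < _) _) (n.+2%:R ^- 2) (n.+2%:R^-1) (n.+1%:R^-1) => S T p q; lra.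
Qed.

(** Cauchy product: each [a_k] meets a tail of [b] of size [1 / (n-k) <= (k+1) / n], and the decay
    of [a_k] pays for [k + 1]. *)
Lemma gsum_conv D D' a b : pow2_bounded D a -> pow2_bounded D' b ->
  gsum (seq_conv a b) = gsum a * gsum b.
Proof.
move=> aD bD.
have D0 : 0 <= D.
  by have := le_trans (normc_ge0 _) (aD 0%N); rewrite expr0 divr1.
have D0' : 0 <= D'.
  by have := le_trans (normc_ge0 _) (bD 0%N); rewrite expr0 divr1.
have [K K0 hK] := pow2_bounded_sum_pow D 1.
apply: (@limn_rate R _ _ (8 * D * normc (gsum b) + 8 * D' * K)) => n n0.
have -> : gsum a * gsum b - \sum_(k < n) seq_conv a b k =
  (gsum a - \sum_(k < n) a k) * gsum b +
  \sum_(k < n) a k * (gsum b - \sum_(m < n - k) b m).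
  have -> : \sum_(k < n) a k * (gsum b - \sum_(m < n - k) b m) =
      (\sum_(k < n) a k) * gsum b - \sum_(k < n) seq_conv a b k.
    by rewrite sum_conv mulr_suml -sumrB; apply: eq_bigr => k _; rewrite mulrBr.
  by rewrite mulrBl addrA subrK.
rewrite [leRHS]mulrDl; apply: le_trans (normcD _ _) _; apply: lerD.
  by rewrite normcM mulrAC ler_wpM2r ?normc_ge0 // gsum_rate.
apply: le_trans (normc_sum _ _ _) _.
apply: le_trans (_ : \sum_(k < n) 8 * D' / n%:R * (normc (a k) * k.+1%:R ^+ 1) <= _).
  apply: ler_sum => k _; rewrite normcM expr1 mulrCA ler_wpM2l ?normc_ge0 //.
  apply: le_trans (gsum_rate bD _) _; first by rewrite subn_gt0.
  rewrite -[leRHS]mulrA ler_wpM2l ?mulr_ge0 // mulrC.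
  exact: inv_sub_le.
by rewrite -mulr_sumr [leRHS]mulrAC ler_wpM2l ?hK // divr_ge0 ?mulr_ge0.
Qed.

End GeometricSequences.

(** * The value [F_s(1) = 2^s] *)

Section ExponentialSum.
Set Implicit Arguments.
Unset Strict Implicit.
Variable R : realType.
Local Notation C := R[i].
Implicit Types (e : nat -> R) (H : C -> C) (s z w h : C) (k n m : nat).

Lemma normc_ub z : exists2 B : nat, (0 < B)%N & normc z <= B%:R.
Proof.
exists (Num.bound (normc z)).+1 => //.
have := archi_boundP (normc_ge0 z); rewrite -natr1 => h.
by apply: le_trans (ltW h) _; rewrite lerDl.
Qed.

Lemma normc_expr_sub1_le z (M : R) n : 1 <= M -> normc z <= M ->
  normc (z ^+ n - 1) <= n%:R * normc (z - 1) * M ^+ n.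
Proof.
move=> M1 zM; elim: n => [|n IH].
  by rewrite expr0 subrr normc0 !mul0r.
have -> : z ^+ n.+1 - 1 = z * (z ^+ n - 1) + (z - 1) by rewrite exprS; ring.
apply: le_trans (normcD _ _) _; rewrite normcM -natr1 [M ^+ n.+1]exprS.
have Mn : 1 <= M ^+ n by rewrite exprn_ege1.
have z0 := normc_ge0 z; have d0 := normc_ge0 (z - 1).
have p0 := normc_ge0 (z ^+ n - 1).
have h : normc z * normc (z ^+ n - 1) <= M * (n%:R * normc (z - 1) * M ^+ n).
  by rewrite ler_pM.
have h2 : normc (z - 1) * 1 <= normc (z - 1) * (M * M ^+ n).
  by rewrite ler_wpM2l //; nra.
by move: (n%:R) h => N h; lra.
Qed.

(** [H s = H (s/N) ^ N] with [H (s/N) = 1 + O(1/N^2)], hence [H s = 1 + O(1/N)]. *)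
Lemma multiplicative_eq1 H (K : R) :
  (forall z w, H (z + w) = H z * H w) ->
  (forall h, normc h <= 1 -> normc (H h - 1) <= K * normc h ^+ 2) ->
  forall s, H s = 1.
Proof.
move=> HM HK s.
have H0 : H 0 = 1.
  apply: normc_sub_le0.
  by have := HK 0; rewrite normc0 expr0n mulr0; apply.
have Hn h n : H (n%:R * h) = H h ^+ n.
  elim: n => [|n IH]; first by rewrite mul0r H0.
  by rewrite -natr1 mulrDl mul1r HM IH exprSr.
have K0 : 0 <= K.
  have := HK 1; rewrite normc1 expr1n mulr1 => /(_ (lexx 1)).
  exact: le_trans (normc_ge0 _).
have [B B0 sB] := normc_ub s.
set c := K * normc s ^+ 2.
have c0 : 0 <= c by rewrite mulr_ge0 ?exprn_ge0 ?normc_ge0.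
apply: normc_sub_le0; apply: (@le0_rate R _ (c * expR c)) => n n0.
(* The factor [B] brings [s / N] into the unit disc, where the quadratic bound applies. *)
set N := (n * B)%N; have N0 : (0 < N)%N by rewrite muln_gt0 n0.
have NR : 1 <= N%:R :> R by rewrite ler1n.
have Nz : N%:R != 0 :> C by rewrite pnatr_eq0 -lt0n.
set h := s / N%:R.
have hN : normc h = normc s / N%:R by rewrite normcM normcV normc_nat.
have h1 : normc h <= 1.
  rewrite hN ler_pdivrMr ?ltr0n // mul1r; apply: le_trans sB _.
  by rewrite ler_nat leq_pmull.
have -> : s = N%:R * h by rewrite mulrC divfK.
rewrite Hn; have hK := HK h h1.
have e2 : K * normc h ^+ 2 = c / N%:R ^+ 2 by rewrite hN exprMn exprVn mulrA.
rewrite e2 in hK.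
have cN : c / N%:R ^+ 2 <= c / N%:R.
  rewrite ler_wpM2l // lef_pV2 ?posrE ?exprn_gt0 ?ltr0n //.
  by rewrite expr2; nra.
set M := expR (c / N%:R).
have M1 : 1 <= M by rewrite -expR0 ler_expR divr_ge0.
have HM' : normc (H h) <= M.
  have -> : H h = (H h - 1) + 1 by ring.
  apply: le_trans (normcD _ _) _; rewrite normc1.
  by have := expR_ge1Dx (c / N%:R); rewrite -/M; lra.
apply: le_trans (normc_expr_sub1_le N M1 HM') _.
have MN : M ^+ N = expR c.
  by rewrite /M -expRM_natl mulrC divfK // pnatr_eq0 -lt0n.
rewrite MN [leRHS]mulrAC ler_wpM2r ?expR_ge0 //.
apply: le_trans (ler_wpM2l _ hK) _ => //.
have -> : N%:R * (c / N%:R ^+ 2) = c / N%:R.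
  by field; rewrite pnatr_eq0 -lt0n.
by rewrite ler_wpM2l // lef_pV2 ?posrE ?ltr0n // ler_nat leq_pmulr.
Qed.

Definition expcoef e s : nat -> C :=
  sval (cid (expseq_exists (fun j => s * (e j)%:C))).

Lemma expcoefP e s : expseq (fun j => s * (e j)%:C) (expcoef e s).
Proof. by rewrite /expcoef; case: cid. Qed.

Lemma expcoef_pow2_bounded e (B : nat) : pow4_bounded e ->
  exists2 D : R, 0 <= D &
    forall s, normc s <= B%:R -> pow2_bounded D (expcoef e s).
Proof.
move=> ge; exists ((4 * B.+1)%:R ^+ (4 * B.+1)); first by rewrite exprn_ge0.
move=> s sB; apply: expseq_pow2_bounded ge (expcoefP e s) _ _ => //.
by apply: le_trans sB _; rewrite ler_nat.
Qed.

(* The value at [1] of [\sum_(k > 0) e_k x^k / k]; the term [k = 0] vanishes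
   because division by zero yields zero. *)
Definition log_value e : R := limn (fun n => \sum_(k < n) e k / k%:R).

Lemma pow4_bounded_le_exp2 e k : pow4_bounded e -> 0 <= e k / k%:R <= 4 / 2 ^+ k.
Proof.
move=> ge; case: k => [|k]; first by rewrite invr0 mulr0 lexx divr_ge0.
have /andP[e0 e1] := ge k.+1 isT; rewrite divr_ge0 //=.
have k1 : 1 <= k.+1%:R :> R by rewrite ler1n.
apply: le_trans (_ : e k.+1 <= _).
  by rewrite ler_pdivrMr ?ltr0n // ler_peMr.
apply: le_trans e1 _; rewrite ler_wpM2l // lef_pV2 ?posrE ?exprn_gt0 //.
by apply: lerXn2r; rewrite ?nnegrE //; lra.
Qed.

Lemma log_value_rate e n : pow4_bounded e -> (0 < n)%N ->
  `|log_value e - \sum_(k < n) e k / k%:R| <= 16 / n%:R.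
Proof.
move=> ge n0.
have [|l hl] := @real_telescoping_limit R (fun n => \sum_(k < n) e k / k%:R) 16.
  move=> m m0; rewrite big_ord_recr /= addrAC subrr add0r.
  have /andP[h0 h1] := pow4_bounded_le_exp2 m ge; rewrite ger0_norm //.
  apply: le_trans h1 _; have := @inv_exp2_le_telescope R m m0.
  by move: (_^-1) (_ - _) => x y; lra.
by have -> : log_value e = l; [exact: real_limn_rate hl|exact: hl].
Qed.

Lemma gsum_expcoefD e z w : pow4_bounded e ->
  gsum (expcoef e (z + w)) = gsum (expcoef e z) * gsum (expcoef e w).
Proof.
move=> ge.
have [Bz _ zB] := normc_ub z; have [Bw _ wB] := normc_ub w.
have [Dz _ Hz] := expcoef_pow2_bounded Bz ge.
have [Dw _ Hw] := expcoef_pow2_bounded Bw ge.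
rewrite -(gsum_conv (Hz z zB) (Hw w wB)); congr gsum; apply/funext => n.
apply: expseq_unique (expcoefP e (z + w)) _ n.
have := expseq_conv (expcoefP e z) (expcoefP e w).
by congr expseq; apply/funext => j; rewrite mulrDl.
Qed.

(** The linear parts of the coefficients add up to [h * log_value e]; their remainders are quadratic
    in [h] and summable. *)
Lemma gsum_expcoef_quadratic e : pow4_bounded e -> exists K : R, forall h,
  normc h <= 1 ->
  normc (gsum (expcoef e h) - 1 - h * (log_value e)%:C) <= K * normc h ^+ 2.
Proof.
move=> ge; have [D D0 HD] := expcoef_pow2_bounded 1 ge.
exists (32 * D) => h h1; have aD := HD h h1; set a := expcoef e h in aD *.
rewrite -subr_le0; apply: (@le0_rate R _ (8 * D + 16)) => -[//|n] _.
set T := \sum_(k < n.+1) e k / k%:R.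
have -> : gsum a - 1 - h * (log_value e)%:C =
    (gsum a - \sum_(k < n.+1) a k) - h * (log_value e - T)%:C +
    (\sum_(k < n.+1) a k - 1 - h * T%:C) by rewrite rmorphB /=; ring.
have r1 := gsum_rate aD (ltn0Sn n).
have r2 : normc (h * (log_value e - T)%:C) <= 16 / n.+1%:R.
  rewrite normcM normc_real; apply: le_trans (log_value_rate ge (ltn0Sn n)).
  by rewrite ler_piMl.
have r3 : normc (\sum_(k < n.+1) a k - 1 - h * T%:C) <= 32 * D * normc h ^+ 2.
  have -> : \sum_(k < n.+1) a k - 1 - h * T%:C =
     \sum_(k < n) (a k.+1 - h * (e k.+1 / k.+1%:R)%:C).
    rewrite big_ord_recl /T big_ord_recl /= invr0 mulr0 add0r.
    have -> : a 0%N = 1 by case: (expcoefP e h).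
    rewrite rmorph_sum mulr_sumr /= sumrB.
    by rewrite [1 + _]addrC addrK.
  apply: le_trans (normc_sum _ _ _) _.
  apply: le_trans (_ : \sum_(k < n) 16 * D * normc h ^+ 2 * (2 ^+ k)^-1 <= _).
    apply: ler_sum => k _.
    apply: le_trans (expseq_sub_linear_le ge aD (expcoefP e h) (ltn0Sn k)) _.
    rewrite ler_wpM2l ?mulr_ge0 ?exprn_ge0 ?normc_ge0 //.
    by rewrite lef_pV2 ?posrE ?exprn_gt0 // ler_weXn2l // ler1n.
  rewrite -mulr_sumr.
  have -> : 32 * D * normc h ^+ 2 = 16 * D * normc h ^+ 2 * 2 by ring.
  rewrite ler_wpM2l ?mulr_ge0 ?exprn_ge0 ?normc_ge0 //.
  apply: le_trans (sum_inv_exp2_le _ _) _.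
  by rewrite lerBlDr lerDl divr_ge0 ?exprn_ge0.
rewrite lerBlDr [(_ + 16) / _]mulrDl.
apply: le_trans (normcD _ _) _; apply: lerD; last exact: r3.
by apply: le_trans (normcB _ _) _; apply: lerD.
Qed.

(** Dividing by the expected exponential leaves a multiplicative function that is [1 + O(h^2)] near
    0, hence constant. *)
Lemma gsum_expcoef e s : pow4_bounded e ->
  gsum (expcoef e s) = cexp (s * (log_value e)%:C).
Proof.
move=> ge; set L := (log_value e)%:C.
have [K HK] := gsum_expcoef_quadratic ge.
set m := normc L.
pose H z := gsum (expcoef e z) * cexp (- (z * L)).
suff : H s = 1.
  move=> h; have -> : gsum (expcoef e s) = H s * cexp (s * L).
    by rewrite /H -mulrA [cexp _ * _]mulrC cexpNK mulr1.
  by rewrite h mul1r.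
apply: (@multiplicative_eq1 H ((K + 3 * m ^+ 2 * expR m) * expR m)) => [z w|h h1].
  by rewrite /H gsum_expcoefD // mulrDl opprD cexpD; ring.
have hm : normc (h * L) <= m by rewrite normcM ler_piMl ?normc_ge0.
have em : expR (normc (h * L)) <= expR m by rewrite ler_expR.
have -> : H h - 1 = (gsum (expcoef e h) - cexp (h * L)) * cexp (- (h * L)).
  by rewrite mulrBl cexpNK.
rewrite normcM -[_ * expR m * _]mulrA [expR m * _]mulrC mulrA.
apply: ler_pM; rewrite ?normc_ge0 //; last first.
  by apply: le_trans (normc_cexp_le _) _; rewrite normcN.
have -> : gsum (expcoef e h) - cexp (h * L) =
   (gsum (expcoef e h) - 1 - h * L) - (cexp (h * L) - 1 - h * L) by ring.
apply: le_trans (normcB _ _) _; rewrite mulrDl; apply: lerD; first exact: HK.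
apply: le_trans (cexp_sub1z_le _) _.
apply: le_trans (_ : 3 * normc (h * L) ^+ 2 * expR m <= _).
  by rewrite ler_wpM2l // mulr_ge0 ?exprn_ge0 ?normc_ge0.
by rewrite normcM -/m exprMn le_eqVlt; apply/orP; left; apply/eqP; ring.
Qed.

Lemma pow4_bounded_pow (y : R) : 0 <= y <= 4^-1 -> pow4_bounded (fun j => y ^+ j).
Proof.
move=> /andP[y0 y1] j _.
rewrite exprn_ge0 //=; apply: le_trans (_ : (4^-1) ^+ j <= _).
  by apply: lerXn2r; rewrite ?nnegrE ?invr_ge0.
by rewrite exprVn ler_peMl ?invr_ge0 ?exprn_ge0 // ler1n.
Qed.

(** For [s = -1] the exponential series is the polynomial [1 - y x], whose value at 1 must be
    [exp (- log_value)]. *)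
Lemma log_value_pow (y : R) : 0 <= y <= 4^-1 -> log_value (fun j => y ^+ j) = - ln (1 - y).
Proof.
move=> yb; have ge := pow4_bounded_pow yb.
pose a n : C := if n is 0 then 1 else if n is 1 then - y%:C else 0.
have aP : expseq (fun j => - 1 * (y ^+ j)%:C) a.
  split=> // -[|n].
    by rewrite big_ord1 /= mul1r mulr1 expr1 mulN1r.
  rewrite /= mulr0 big_ord_recr big_ord_recr /= subnn subSnn /= mulr1.
  rewrite big1 ?add0r => [|i _]; first by rewrite !mulN1r [y ^+ n.+2]exprSr rmorphM; ring.
  have : (1 < n.+1 - i)%N by rewrite ltn_subRL addn1 ltnS.
  by case: (n.+1 - i)%N => [|[|k]] // _; rewrite mulr0.
have aE : expcoef (fun j => y ^+ j) (-1) = a.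
  by apply/funext; apply: expseq_unique (expcoefP _ _) aP.
have := gsum_expcoef (-1) ge; rewrite aE.
have -> : gsum a = (1 - y)%:C.
  apply: (@limn_rate R _ _ `|y|) => -[//|[|n]] _.
    by rewrite big_ord1 rmorphB rmorph1 addrAC subrr add0r normcN normc_real divr1.
  rewrite big_ord_recl big_ord_recl big1 // addr0 rmorphB rmorph1 subrr.
  by rewrite normc0 divr_ge0.
rewrite mulN1r -rmorphN cexp_real => /complexI h.
by rewrite h expRK opprK.
Qed.

Lemma log_value_zeta_tail : log_value (@zeta_tail R) = ln 2.
Proof.
have gz : pow4_bounded (@zeta_tail R) by move=> j; exact: zeta_tail_pow4_bounded.
pose y m : R := (m.+2%:R ^+ 2)^-1.
have yb m : 0 <= y m <= 4^-1.
  rewrite invr_ge0 exprn_ge0 //= lef_pV2 ?posrE ?exprn_gt0 //.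
  have : 2 <= m.+2%:R :> R by rewrite ler_nat.
  by nra.
have gy m : pow4_bounded (fun j => y m ^+ j) := pow4_bounded_pow (yb m).
pose S M := \sum_(m < M) log_value (fun j => y m ^+ j).
(* [1 - y_M] is [(M+1)(M+3) / (M+2)^2], a quotient of consecutive ratios, so the logarithms
   telescope. *)
have SE M : S M = ln 2 - ln (M.+2%:R / M.+1%:R).
  elim: M => [|M IH]; first by rewrite /S big_ord0 divr1 subrr.
  rewrite /S big_ord_recr /= -/(S M) IH log_value_pow //.
  have M1 : 0 < M.+1%:R :> R by rewrite ltr0n.
  have p0 : 0 < M.+2%:R / M.+1%:R :> R by rewrite divr_gt0 ?ltr0n.
  have q0 : 0 < M.+3%:R / M.+2%:R :> R by rewrite divr_gt0 ?ltr0n.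
  have -> : 1 - y M = (M.+3%:R / M.+2%:R) / (M.+2%:R / M.+1%:R).
    rewrite /y -[M.+3%:R]natr1 -[M.+2%:R]natr1; move: (M.+1%:R) M1 => x x0.
    by field; rewrite !lt0r_neq0 //; lra.
  move: (_ / _) (_ / _) p0 q0 => p q p0 q0.
  by rewrite ln_div ?posrE //; ring.
have partE M j : zeta_tail_part R M j = \sum_(m < M) y m ^+ j.
  by apply: eq_bigr => m _; rewrite exprVn -exprM.
(* This bound is uniform in [n], so [n] can tend to infinity first, with [M] fixed. *)
have close M n : `|\sum_(k < n) zeta_tail R k / k%:R -
    \sum_(m < M) \sum_(k < n) y m ^+ k / k%:R| <= 8 / M.+1%:R.
  rewrite exchange_big /= -sumrB; apply: le_trans (ler_norm_sum _ _ _) _.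
  apply: le_trans (_ : \sum_(k < n) 4 / M.+1%:R * (2 ^+ k)^-1 <= _).
    apply: ler_sum => -[[|k] ki] _ /=.
      under eq_bigr do rewrite invr0 mulr0.
      by rewrite invr0 mulr0 big1 // subrr normr0 expr0 invr1 mulr1 divr_ge0.
    rewrite -mulr_suml -partE -mulrBl normrM normfV [`|k.+1%:R|]ger0_norm //.
    have /andP[h1 h2] := zeta_tail_bounds R M (ltn0Sn k).
    rewrite ger0_norm ?subr_ge0 //.
    apply: le_trans (_ : zeta_tail R k.+1 - zeta_tail_part R M k.+1 <= _).
      by rewrite ler_pdivrMr ?ltr0n // ler_peMr ?subr_ge0 // ler1n.
    apply: le_trans (_ : 4 / 4 ^+ k.+1 / M.+1%:R <= _); first by rewrite lerBlDl.
    rewrite mulrAC ler_wpM2l ?divr_ge0 // lef_pV2 ?posrE ?exprn_gt0 //.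
    by apply: lerXn2r; rewrite ?nnegrE //; lra.
  rewrite -mulr_sumr; have -> : 8 / M.+1%:R = 4 / M.+1%:R * 2 :> R by ring.
  rewrite ler_wpM2l ?divr_ge0 //; apply: le_trans (sum_inv_exp2_le _ _) _.
  by rewrite lerBlDr lerDl divr_ge0 ?exprn_ge0.
have LS M : `|log_value (@zeta_tail R) - S M| <= 8 / M.+1%:R.
  rewrite -subr_le0; apply: (@le0_rate R _ (16 + 16 * M%:R)) => n n0.
  rewrite lerBlDr.
  have -> : log_value (@zeta_tail R) - S M =
    (log_value (@zeta_tail R) - \sum_(k < n) zeta_tail R k / k%:R) +
    (- \sum_(m < M) (log_value (fun j => y m ^+ j) - \sum_(k < n) y m ^+ k / k%:R)) +
    (\sum_(k < n) zeta_tail R k / k%:R - \sum_(m < M) \sum_(k < n) y m ^+ k / k%:R).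
    by rewrite sumrB -/(S M); ring.
  apply: le_trans (ler_normD _ _) _; apply: lerD; last exact: close.
  rewrite [leRHS]mulrDl; apply: le_trans (ler_normD _ _) _; apply: lerD.
    exact: log_value_rate.
  rewrite normrN; apply: le_trans (ler_norm_sum _ _ _) _.
  apply: le_trans (_ : \sum_(m < M) 16 / n%:R <= _).
    by apply: ler_sum => m _; exact: log_value_rate.
  by rewrite sumr_const card_ord -[_ *+ M]mulr_natr [leLHS]mulrAC.
apply/eqP; rewrite -subr_eq0 -normr_le0.
(* 9 is 8 from [LS] plus 1 from [ln (1 + 1/(M+1)) <= 1/(M+1)]. *)
apply: (@le0_rate R _ 9) => -[//|M] _; have := LS M; rewrite SE.
have M1 : 0 < M.+1%:R :> R by rewrite ltr0n.
have p0 : 1 <= M.+2%:R / M.+1%:R :> R by rewrite ler_pdivlMr // mul1r ler_nat.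
have l0 := ln_ge0 p0.
have : ln (M.+2%:R / M.+1%:R) <= M.+1%:R^-1 :> R.
  have -> : M.+2%:R / M.+1%:R = 1 + M.+1%:R^-1 :> R.
    by rewrite -[M.+2%:R]natr1 mulrDl mul1r divff // lt0r_neq0.
  by apply: le_ln1Dx; rewrite (lt_le_trans (ltrN10 _)) ?invr_ge0.
move: (M.+1%:R^-1) (ln (M.+2%:R / M.+1%:R)) l0 => x l l0 lx.
have := ler_normD (log_value (@zeta_tail R) - (ln 2 - l)) (- l).
have -> : log_value (@zeta_tail R) - (ln 2 - l) - l = log_value (@zeta_tail R) - ln 2 by ring.
by rewrite normrN (ger0_norm l0); lra.
Qed.

End ExponentialSum.

(** * Approximation and lower bounds of [1 / Gamma (1 + s)] *)

Section ReciprocalGamma.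
Set Implicit Arguments.
Unset Strict Implicit.
Variable R : realType.
Local Notation C := R[i].
Implicit Types (s z : C) (c B x : R) (v : nat -> C) (k n N : nat).

(* Converges to [1 / Gamma (1 + s)]. *)
Definition rGamma_approx s n : C :=
  cexp (- (s * (ln n%:R)%:C)) * (\prod_(k < n.-1) (s + k.+1%:R)) / n.-1`!%:R.

Lemma rGamma_approx1 s : rGamma_approx s 1 = 1.
Proof. by rewrite /rGamma_approx big_ord0 ln1 mulr0 oppr0 cexp0 fact0 divr1 mulr1. Qed.

Lemma rGamma_approxS s n : (0 < n)%N ->
  rGamma_approx s n.+1 = rGamma_approx s n *
    ((1 + s / n%:R) * cexp (- (s * (ln (1 + n%:R^-1))%:C))).
Proof.
case: n => // n _; rewrite /rGamma_approx /= big_ord_recr /= factS natrM.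
have n0 : 0 < n.+1%:R :> R by rewrite ltr0n.
have -> : ln n.+2%:R = ln n.+1%:R + ln (1 + n.+1%:R^-1) :> R.
  rewrite -lnM ?posrE ?ltr_wpDr ?invr_ge0 //; congr ln.
  by rewrite mulrDr mulr1 divff ?lt0r_neq0 // natr1.
rewrite rmorphD mulrDr opprD cexpD /=.
have nz : n.+1%:R != 0 :> C by rewrite pnatr_eq0.
have fz : n`!%:R != 0 :> C by rewrite pnatr_eq0 -lt0n fact_gt0.
by move: (n.+1%:R : C) (n`!%:R : C) nz fz => x y nz fz; field; rewrite nz fz.
Qed.

Lemma ln1D_bounds x : 0 < x -> x - x ^+ 2 <= ln (1 + x) <= x.
Proof.
move=> x0; have x1 : 0 < 1 + x by lra.
apply/andP; split; last by apply: le_ln1Dx; lra.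
have : ln (1 + - (x / (1 + x))) <= - (x / (1 + x)).
  by apply: le_ln1Dx; rewrite ltrN2 ltr_pdivrMr //; lra.
have -> : 1 + - (x / (1 + x)) = (1 + x)^-1 by field; rewrite lt0r_neq0.
rewrite lnV ?posrE // lerN2 => h; apply: le_trans h.
by rewrite ler_pdivlMr //; nra.
Qed.

(** Collects the coefficients of [x^2], [x = 1/n], in the three remainders of [ratio_sub1_le]; the
    outer 2 comes from [x^2 <= 2 (1/n - 1/(n+1))]. *)
Definition ratio_const B : R :=
  2 * ((1 + B) * (3 * B ^+ 2 * expR B) + B + B ^+ 2).

Lemma ratio_const_ge0 B : 0 <= B -> 0 <= ratio_const B.
Proof. by move=> B0; rewrite mulr_ge0 ?addr_ge0 ?mulr_ge0 ?exprn_ge0 ?expR_ge0 ?addr_ge0. Qed.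

Lemma ratio_sub1_le s B n : (0 < n)%N -> normc s <= B ->
  normc ((1 + s / n%:R) * cexp (- (s * (ln (1 + n%:R^-1))%:C)) - 1) <=
    ratio_const B * (n%:R^-1 - n.+1%:R^-1).
Proof.
move=> n0 sB; have nR : 0 < n%:R :> R by rewrite ltr0n.
have m0 := normc_ge0 s; have B0 := le_trans m0 sB.
set x := n%:R^-1 : R; have x0 : 0 < x by rewrite invr_gt0.
have x1 : x <= 1 by rewrite invf_le1 // ler1n.
have -> : n.+1%:R^-1 = x / (1 + x).
  by rewrite /x -natr1; field; rewrite !lt0r_neq0 //; lra.
have x2 : x ^+ 2 <= 2 * (x - x / (1 + x)).
  have -> : x - x / (1 + x) = x ^+ 2 / (1 + x) by field; rewrite lt0r_neq0 //; lra.
  rewrite mulrA ler_pdivlMr; last by lra.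
  by nra.
have -> : s / n%:R = s * x%:C by rewrite fmorphV rmorph_nat.
have /andP[l1 l2] := ln1D_bounds x0.
set l := ln (1 + x) in l1 l2 *.
have l0 : 0 <= l by rewrite ln_ge0 //; lra.
(* The first-order terms [s x] and [- s l] nearly cancel because [l = ln (1 + x)]; all that remains
   is [O(x^2)]. *)
have -> : (1 + s * x%:C) * cexp (- (s * l%:C)) - 1 =
  (1 + s * x%:C) * (cexp (- (s * l%:C)) - 1 - - (s * l%:C)) +
  (s * (x - l)%:C - s ^+ 2 * (x * l)%:C).
  by rewrite rmorphB rmorphM /=; ring.
have sl : normc (- (s * l%:C)) <= B * x.
  by rewrite normcN normcM normc_real ger0_norm // ler_pM.
have slB : normc (- (s * l%:C)) <= B by apply: le_trans sl _; rewrite ler_piMr.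
have r1 : normc (cexp (- (s * l%:C)) - 1 - - (s * l%:C)) <= 3 * B ^+ 2 * expR B * x ^+ 2.
  apply: le_trans (cexp_sub1z_le _) _.
  have -> : 3 * B ^+ 2 * expR B * x ^+ 2 = 3 * (B * x) ^+ 2 * expR B by ring.
  apply: ler_pM; rewrite ?mulr_ge0 ?exprn_ge0 ?expR_ge0 ?normc_ge0 ?ler_expR //.
  rewrite ler_wpM2l //.
  by apply: lerXn2r; rewrite ?nnegrE ?normc_ge0 ?mulr_ge0 // ltW.
have r2 : normc (1 + s * x%:C) <= 1 + B.
  apply: le_trans (normcD _ _) _; rewrite normc1 lerD2l normcM normc_real.
  by rewrite gtr0_norm // -[B]mulr1 ler_pM // (ltW x0).
have r3 : normc (s * (x - l)%:C) <= B * x ^+ 2.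
  by rewrite normcM normc_real ler_pM // ger0_norm; lra.
have r4 : normc (s ^+ 2 * (x * l)%:C) <= B ^+ 2 * x ^+ 2.
  rewrite normcM normcX normc_real ger0_norm ?mulr_ge0 ?(ltW x0) //.
  apply: ler_pM; rewrite ?exprn_ge0 ?mulr_ge0 ?(ltW x0) //.
    by apply: lerXn2r; rewrite ?nnegrE.
  by rewrite expr2 ler_wpM2l // ltW.
apply: le_trans (normcD _ _) _; rewrite normcM.
have r5 := normcB (s * (x - l)%:C) (s ^+ 2 * (x * l)%:C).
have r6 := ler_pM (normc_ge0 _) (normc_ge0 _) r2 r1.
apply: le_trans (_ : ratio_const B / 2 * x ^+ 2 <= _).
  by rewrite /ratio_const; lra.
have -> : ratio_const B * (x - x / (1 + x)) = ratio_const B / 2 * (2 * (x - x / (1 + x))).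
  by field; rewrite lt0r_neq0 //; lra.
by rewrite ler_wpM2l // divr_ge0 // ratio_const_ge0.
Qed.

(** A discrete Gronwall inequality. The bounds are proportional to [normc (v N)], which is what
    allows a lower bound on the limit. *)
Lemma ratio_growth v c N : 0 <= c -> (0 < N)%N ->
  (forall n, (N <= n)%N ->
    normc (v n.+1 - v n) <= normc (v n) * (c * (n%:R^-1 - n.+1%:R^-1))) ->
  forall n, (N <= n)%N ->
    normc (v n) <= normc (v N) * expR c /\
    normc (v n - v N) <= normc (v N) * (expR c * c / N%:R).
Proof.
move=> c0 N0 hv.
have d0 n : (0 < n)%N -> 0 <= n%:R^-1 - n.+1%:R^-1 :> R.
  by move=> n0; rewrite subr_ge0 lef_pV2 ?posrE ?ltr0n // ler_nat.
have N1 : N%:R^-1 <= 1 :> R by rewrite invf_le1 ?ltr0n // ler1n.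
have ge k : normc (v (N + k)%N) <= normc (v N) * expR (c * (N%:R^-1 - (N + k)%:R^-1)).
  elim: k => [|k IH]; first by rewrite addn0 subrr mulr0 expR0 mulr1.
  rewrite addnS; set n := (N + k)%N in IH *.
  have -> : v n.+1 = (v n.+1 - v n) + v n by rewrite subrK.
  apply: le_trans (normcD _ _) _.
  apply: le_trans (lerD (hv n (leq_addr _ _)) (lexx _)) _.
  set d := n%:R^-1 - n.+1%:R^-1.
  have -> : c * (N%:R^-1 - n.+1%:R^-1) = c * (N%:R^-1 - n%:R^-1) + c * d.
    by rewrite /d; ring.
  have -> : normc (v n) * (c * d) + normc (v n) = normc (v n) * (c * d + 1) by ring.
  rewrite expRD mulrA; apply: ler_pM; rewrite ?normc_ge0 ?addr_ge0 ?mulr_ge0 ?d0 ?ltn_addr //.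
  by rewrite addrC; exact: expR_ge1Dx.
have bound k : normc (v (N + k)%N) <= normc (v N) * expR c.
  apply: le_trans (ge k) _; rewrite ler_wpM2l ?normc_ge0 // ler_expR.
  rewrite ler_piMr //; have : 0 <= (N + k)%:R^-1 :> R by rewrite invr_ge0.
  lra.
move=> n Nn; rewrite -(subnKC Nn); split; first exact: bound.
apply: le_trans (_ : normc (v N) * (expR c * c * (N%:R^-1 - (N + (n - N))%:R^-1)) <= _).
  elim: (n - N)%N => [|k IH]; first by rewrite addn0 !subrr !mulr0 normc0.
  rewrite addnS; set m := (N + k)%N in IH *.
  have -> : v m.+1 - v N = (v m.+1 - v m) + (v m - v N) by rewrite addrA subrK.
  apply: le_trans (normcD _ _) _.
  have := hv m (leq_addr _ _); set d := m%:R^-1 - m.+1%:R^-1 => h.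
  have h' : normc (v m.+1 - v m) <= normc (v N) * expR c * (c * d).
    by apply: le_trans h _; rewrite ler_wpM2r ?bound // mulr_ge0 // d0 // ltn_addr.
  apply: le_trans (lerD h' IH) _; rewrite /d le_eqVlt; apply/orP; left.
  by apply/eqP; ring.
rewrite ler_wpM2l ?normc_ge0 // ler_wpM2l ?mulr_ge0 ?expR_ge0 //.
by rewrite lerBlDr lerDl invr_ge0.
Qed.

Lemma rGamma_approx_growth s B N n : normc s <= B -> (0 < N)%N -> (N <= n)%N ->
  let c := ratio_const B in
  normc (rGamma_approx s n) <= normc (rGamma_approx s N) * expR c /\
  normc (rGamma_approx s n - rGamma_approx s N) <=
    normc (rGamma_approx s N) * (expR c * c / N%:R).
Proof.
move=> sB N0 Nn c; have B0 := le_trans (normc_ge0 s) sB.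
apply: (ratio_growth (ratio_const_ge0 B0) N0 _ Nn) => m Nm.
have m0 : (0 < m)%N by apply: leq_trans Nm.
rewrite rGamma_approxS // -{2}[rGamma_approx s m]mulr1 -mulrBr normcM.
by rewrite ler_wpM2l ?normc_ge0 // ratio_sub1_le.
Qed.

(** Euler's product at [1 + s] has the two further factors [s + n] and [s + n + 1]; divided by [n],
    both tend to 1. *)
Lemma rGamma_prod s n : (0 < n)%N ->
  (\prod_(0 <= k < n.+1) (1 + s + k%:R)) / (n`!%:R * cpow n%:R (1 + s)) =
  rGamma_approx s n * ((1 + s / n%:R) * (1 + (s + 1) / n%:R)).
Proof.
case: n => // n _; rewrite big_mkord /rGamma_approx /= !big_ord_recr /=.
under eq_bigr => k _ do rewrite addrAC [1 + _]addrC natr1 addrC.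
rewrite cpowE mulrDl mul1r cexpD cexp_real lnK ?posrE ?ltr0n //.
have -> : cexp (s * (ln n.+1%:R)%:C) = (cexp (- (s * (ln n.+1%:R)%:C)))^-1.
  by apply: (mulIf (cexp_neq0 (- (s * (ln n.+1%:R)%:C)))); rewrite cexpNK mulVf ?cexp_neq0.
have -> : 1 + s + n%:R = s + n.+1%:R by rewrite -natr1; ring.
rewrite rmorph_nat factS natrM.
have nz : n.+1%:R != 0 :> C by rewrite pnatr_eq0.
have fz : n`!%:R != 0 :> C by rewrite pnatr_eq0 -lt0n fact_gt0.
have cz := cexp_neq0 (- (s * (ln n.+1%:R)%:C)).
move: (n.+1%:R : C) (n`!%:R : C) (cexp _) nz fz cz => x y w nz fz cz.
by field; rewrite nz fz cz.
Qed.

Lemma rGamma_rate B : exists2 c, 0 <= c & forall s n, normc s <= B -> (0 < n)%N ->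
  normc (rGamma_approx s n) <= c /\
  normc (rGamma (1 + s) - rGamma_approx s n) <= c / n%:R.
Proof.
have [B0|B0] := leP 0 B; last first.
  by exists 0 => // s n /(le_trans (normc_ge0 s)); rewrite leNgt B0.
set c := ratio_const B; have c0 : 0 <= c by exact: ratio_const_ge0.
have ec : 0 <= expR c * c by rewrite mulr_ge0 ?expR_ge0.
exists (expR c + 2 * (expR c * c)).
  by rewrite addr_ge0 ?expR_ge0 // mulr_ge0.
move=> s n sB n0.
have ub m : (0 < m)%N -> normc (rGamma_approx s m) <= expR c.
  move=> m0; have [] := rGamma_approx_growth sB (ltn0Sn 0) m0.
  by rewrite rGamma_approx1 normc1 mul1r.
have [|l hl] := @telescoping_limit R (rGamma_approx s) (expR c * c).
  move=> m m0; rewrite rGamma_approxS // -{2}[rGamma_approx s m]mulr1 -mulrBr normcM.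
  by rewrite -mulrA ler_pM ?normc_ge0 ?ub // ratio_sub1_le.
have -> : rGamma (1 + s) = l.
  set K := 2 * (expR c * c) + expR c * (B + (B + 1) + B * (B + 1)).
  apply: (@limn_rate R _ _ K) => m m0; rewrite rGamma_prod //.
  have -> : l - rGamma_approx s m * ((1 + s / m%:R) * (1 + (s + 1) / m%:R)) =
      (l - rGamma_approx s m) - rGamma_approx s m *
        (s / m%:R + (s + 1) / m%:R + s / m%:R * ((s + 1) / m%:R)) by ring.
  rewrite [leRHS]mulrDl; apply: le_trans (normcB _ _) _; apply: lerD; first exact: hl.
  rewrite normcM -[leRHS]mulrA; apply: ler_pM; rewrite ?normc_ge0 ?ub //.
  have nV : normc (m%:R^-1 : C) = m%:R^-1 by rewrite normcV normc_nat.
  have m1 : m%:R^-1 <= 1 :> R by rewrite invf_le1 ?ltr0n // ler1n.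
  have mV : 0 <= m%:R^-1 :> R by rewrite invr_ge0.
  have s1 : normc (s + 1) <= B + 1.
    by apply: le_trans (normcD _ _) _; rewrite normc1 lerD2r.
  have B1 : 0 <= B + 1 by rewrite addr_ge0.
  rewrite [leRHS]mulrDl [X in _ <= X + _]mulrDl; apply: le_trans (normcD _ _) _; apply: lerD.
    apply: le_trans (normcD _ _) _.
    by apply: lerD; rewrite normcM nV ler_wpM2r.
  rewrite !normcM nV -[leRHS]mulrA; apply: ler_pM; rewrite ?mulr_ge0 ?normc_ge0 //.
    by rewrite -[leRHS]mulr1 ler_pM ?normc_ge0.
  by rewrite ler_wpM2r.
split; first by apply: le_trans (ub n n0) _; rewrite lerDl mulr_ge0.
apply: le_trans (hl n n0) _; rewrite ler_wpM2r ?invr_ge0 //.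
by rewrite lerDr expR_ge0.
Qed.

(** Beyond a suitable [N] the approximants move by at most half of [normc (rGamma_approx s N)], so
    the limit keeps the other half. The approximant at [N] is a finite product, bounded below factor
    by factor. *)
Lemma rGamma_lower_bound (A : set C) B :
  (forall s, A s -> normc s <= B) ->
  (forall k, exists2 d : R, 0 < d & forall s, A s -> d <= normc (s + k.+1%:R)) ->
  exists2 d : R, 0 < d & forall s, A s -> d <= normc (rGamma (1 + s)).
Proof.
move=> AB Ak.
have [c c0 hc] := rGamma_rate B.
set r := expR (ratio_const B) * ratio_const B.
set N := (Num.bound (2 * `|r|)).+1.
have N0 : 0 < N%:R :> R by rewrite ltr0n.
have rN : r / N%:R <= 2^-1.
  rewrite ler_pdivrMr // ler_pdivlMl //.
  apply: le_trans (_ : 2 * `|r| <= _); first by rewrite ler_wpM2l // ler_norm.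
  apply: le_trans (ltW (archi_boundP _)) _; first by rewrite mulr_ge0.
  by rewrite ler_nat.
have [p p0 hp] : exists2 d : R, 0 < d &
    forall s, A s -> d <= normc (\prod_(k < N.-1) (s + k.+1%:R)).
  elim: (N.-1) => [|n [d d0 hd]].
    by exists 1 => // s _; rewrite big_ord0 normc1.
  have [d' d0' hd'] := Ak n; exists (d * d'); first by rewrite mulr_gt0.
  move=> s As; rewrite big_ord_recr normcM /=.
  by apply: ler_pM; rewrite ?(ltW d0) ?(ltW d0') ?hd ?hd'.
have f0 : 0 < N.-1`!%:R :> R by rewrite ltr0n fact_gt0.
(* The first factor is [N^-B], a lower bound for the modulus of [N^-s]. *)
pose q := expR (- (B * ln N%:R)) * p / N.-1`!%:R.
have q0 : 0 < q by rewrite divr_gt0 // mulr_gt0 ?expR_gt0.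
exists (q / 2); first by rewrite divr_gt0.
move=> s As; have sB := AB s As.
have qs : q <= normc (rGamma_approx s N).
  rewrite /rGamma_approx normcM normcV normc_nat normcM normc_cexp.
  rewrite ler_wpM2r ?invr_ge0 //; apply: ler_pM; rewrite ?expR_ge0 ?(ltW p0) //; last exact: hp.
  rewrite ler_expR lerNl.
  have -> : - complex.Re (- (s * (ln N%:R)%:C)) = complex.Re s * ln N%:R.
    by case: (s) => a b /=; rewrite mulr0 subr0 opprK.
  rewrite ler_wpM2r ?ln_ge0 ?ler1n //.
  by apply: le_trans (ler_norm _) _; apply: le_trans (Re_le_normc s) _.
rewrite -subr_le0; apply: (@le0_rate R _ c) => n n0.
have [_ h1] := hc s (N + n)%N sB (ltn_addl _ n0).
have [_ h2] := rGamma_approx_growth sB (ltn0Sn _) (leq_addr n N).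
have h3 : c / (N + n)%:R <= c / n%:R.
  by rewrite ler_wpM2l // lef_pV2 ?posrE ?ltr0n ?ltn_addl // ler_nat leq_addl.
have h4 : normc (rGamma_approx s N) <= normc (rGamma (1 + s)) +
    normc (rGamma (1 + s) - rGamma_approx s (N + n)) +
    normc (rGamma_approx s (N + n) - rGamma_approx s N).
  have {1}-> : rGamma_approx s N = rGamma (1 + s) -
    (rGamma (1 + s) - rGamma_approx s (N + n)) -
    (rGamma_approx s (N + n) - rGamma_approx s N) by ring.
  apply: le_trans (normcB _ _) _; rewrite lerD2r; exact: normcB.
have h5 : normc (rGamma_approx s N) * (r / N%:R) <= normc (rGamma_approx s N) * 2^-1.
  by rewrite ler_wpM2l ?normc_ge0.
have h6 := le_trans h2 h5; have h7 := le_trans h1 h3.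
move: h4 h6 h7 qs; move: (normc _) (normc _) (normc _) (normc _) (c / _).
by move=> x1 x2 x3 x4 x5; lra.
Qed.

End ReciprocalGamma.

(** * Asymptotics of the coefficients [a_n(s)] *)

Section CoefficientAsymptotics.
Set Implicit Arguments.
Unset Strict Implicit.
Variable R : realType.
Local Notation C := R[i].
Implicit Types (s : C) (a : nat -> C) (j k n m : nat).

(** These are the coefficients of [(1 - x)^-s], since [- s ln (1 - x)] is the sum of the
    [s x^j / j]. *)
Lemma expseq_rising s :
  expseq (fun=> s) (fun n => (\prod_(k < n) (s + k%:R)) / n`!%:R).
Proof.
set c := (c in expseq _ c); split; first by rewrite /c big_ord0 fact0 divr1.
have cS n : n.+1%:R * c n.+1 = (s + n%:R) * c n.
  rewrite /c big_ord_recr factS natrM /=.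
  have nz : n.+1%:R != 0 :> C by rewrite pnatr_eq0.
  have fz : n`!%:R != 0 :> C by rewrite pnatr_eq0 -lt0n fact_gt0.
  by move: (n.+1%:R : C) (n`!%:R : C) nz fz => x y nz fz; field; rewrite nz fz.
elim=> [|n IH]; rewrite cS big_ord_recl subn0 mulrDl; first by rewrite big_ord0 mul0r.
by congr (_ + _); rewrite IH; apply: eq_bigr.
Qed.

Lemma rising_rGamma_approx s n : (0 < n)%N ->
  (\prod_(k < n) (s + k%:R)) / n`!%:R =
  s / n%:R * cexp (s * (ln n%:R)%:C) * rGamma_approx s n.
Proof.
case: n => // n _; rewrite big_ord_recl /= addr0 factS natrM /rGamma_approx /=.
have cE := cexpNK (s * (ln n.+1%:R)%:C).
have nz : n.+1%:R != 0 :> C by rewrite pnatr_eq0.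
have fz : n`!%:R != 0 :> C by rewrite pnatr_eq0 -lt0n fact_gt0.
set P := (\prod_(k < n) _ in RHS); rewrite -/P.
have -> : s / n.+1%:R * cexp (s * (ln n.+1%:R)%:C) *
    (cexp (- (s * (ln n.+1%:R)%:C)) * P / n`!%:R) =
    s / n.+1%:R * (cexp (s * (ln n.+1%:R)%:C) * cexp (- (s * (ln n.+1%:R)%:C))) *
    (P / n`!%:R) by ring.
rewrite cE mulr1.
move: (n.+1%:R : C) (n`!%:R : C) nz fz => x y nz fz.
by rewrite /P; field; rewrite nz fz.
Qed.

(** The relative cost of replacing [(n-k)^(s-1)] by [n^(s-1)]. Both [ln (n/(n-k)) <= (k+1)^2 / n]
    and [n/(n-k) <= k+1] enter; the polynomial growth in [k] is harmless against [2^-k]. *)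
Lemma cexp_ratio_le s (B n k : nat) : normc s <= B%:R -> (k < n)%N ->
  normc (cexp ((1 - s) * (ln (n%:R / (n - k)%:R))%:C) - 1) <=
    4 * B.+1%:R / n%:R * k.+1%:R ^+ (2 * B.+1 + 2).
Proof.
move=> sB kn; have n0 : 0 < n%:R :> R by rewrite ltr0n (leq_ltn_trans _ kn).
have m0 : 0 < (n - k)%:R :> R by rewrite ltr0n subn_gt0.
have r1 : 1 <= n%:R / (n - k)%:R :> R.
  by rewrite ler_pdivlMr // mul1r ler_nat leq_subr.
have r0 := lt_le_trans ltr01 r1.
have rk : n%:R / (n - k)%:R <= k.+1%:R :> R.
  by rewrite ler_pdivrMr // -natrM ler_nat mulnC leq_mul_sub.
set l := ln _; have l0 : 0 <= l by exact: ln_ge0.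
have lk : l <= k.+1%:R ^+ 2 / n%:R.
  apply: le_trans (_ : k%:R / (n - k)%:R <= _).
    have -> : l = ln (1 + k%:R / (n - k)%:R).
      congr ln; rewrite natrB ?(ltnW kn) // in m0 *.
      by field; rewrite lt0r_neq0.
    by apply: le_ln1Dx; rewrite (lt_le_trans (ltrN10 _)) ?divr_ge0.
  rewrite expr2 -mulrA; apply: ler_pM; rewrite ?invr_ge0 ?ler_nat //.
  exact: inv_sub_le.
have s1 : normc (1 - s) <= B.+1%:R.
  by apply: le_trans (normcB _ _) _; rewrite normc1 -natr1 addrC lerD2r.
have wE : normc ((1 - s) * l%:C) = normc (1 - s) * l.
  by rewrite normcM normc_real ger0_norm.
apply: le_trans (cexp_sub1_le _) _; rewrite wE.
have e1 : expR (2 * (normc (1 - s) * l)) <= k.+1%:R ^+ (2 * B.+1).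
  apply: le_trans (_ : expR ((2 * B.+1)%:R * l) <= _).
    by rewrite ler_expR natrM -mulrA ler_wpM2l // ler_wpM2r.
  rewrite expRM_natl lnK ?posrE //.
  by apply: lerXn2r; rewrite ?nnegrE // ltW.
have e2 : normc (1 - s) * l <= B.+1%:R * (k.+1%:R ^+ 2 / n%:R).
  by rewrite ler_pM ?normc_ge0.
rewrite exprD.
have -> : 4 * B.+1%:R / n%:R * (k.+1%:R ^+ (2 * B.+1) * k.+1%:R ^+ 2) =
   (B.+1%:R * (k.+1%:R ^+ 2 / n%:R) * 4) * k.+1%:R ^+ (2 * B.+1) :> R by ring.
apply: ler_pM; rewrite ?expR_ge0 ?mulr_ge0 ?normc_ge0 //.
by rewrite ler_wpM2r.
Qed.

(** The last term of the convolution is [f n], which has no rising factorial to supply a factor [s];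
    its own recursion supplies [s / n]. Thus [s] comes out of the whole sum. *)
Lemma zeta_coef_decomp s a n : (0 < n)%N ->
  expseq (fun j => s * (zeta (2 * j)%:R)%:C) a ->
  let f := expcoef (@zeta_tail R) s in
  a n = s / n%:R * cexp (s * (ln n%:R)%:C) *
    (cexp (- (s * (ln n%:R)%:C)) * (\sum_(j < n) (zeta_tail R j.+1)%:C * f (n.-1 - j)%N) +
     \sum_(k < n) f k * (rGamma_approx s (n - k) *
        cexp ((1 - s) * (ln (n%:R / (n - k)%:R))%:C))).
Proof.
move=> n0 aP f.
have fP : expseq _ f := expcoefP (@zeta_tail R) s.
have := expseq_conv fP (expseq_rising s).
have -> : (fun j => s * (zeta_tail R j)%:C + s) = (fun j => s * (zeta (2 * j)%:R)%:C).
  by apply/funext => j; rewrite /zeta_tail rmorphB rmorph1; ring.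
move/(expseq_unique aP) => ->; rewrite /seq_conv big_ord_recr /= subnn big_ord0 fact0 divr1 mulr1.
have nz : n%:R != 0 :> C by rewrite pnatr_eq0 -lt0n.
rewrite mulrDr addrC; congr (_ + _).
  rewrite -mulrA [cexp _ * (_ * _)]mulrA cexpNK mul1r; apply: (mulfI nz).
  rewrite mulrA [n%:R * (s / _)]mulrC divfK //.
  case: (n) n0 => // m _; case: fP => _ -> /=; rewrite mulr_sumr.
  by apply: eq_bigr => j _; rewrite mulrA.
rewrite mulr_sumr; apply: eq_bigr => k _.
have m0 : (0 < n - k)%N by rewrite subn_gt0.
rewrite rising_rGamma_approx //.
have mR : 0 < (n - k)%:R :> R by rewrite ltr0n.
have nR : 0 < n%:R :> R by rewrite ltr0n.
have mz : (n - k)%:R != 0 :> C by rewrite pnatr_eq0 -lt0n.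
rewrite ln_div ?posrE //.
have -> : (1 - s) * (ln n%:R - ln (n - k)%:R)%:C =
   (ln n%:R)%:C - (ln (n - k)%:R)%:C + - (s * (ln n%:R)%:C) + s * (ln (n - k)%:R)%:C.
  by rewrite rmorphB /=; ring.
rewrite !cexpD -rmorphN !cexp_real expRN !lnK ?posrE // fmorphV !rmorph_nat.
have cE := cexpNK (s * (ln n%:R)%:C).
move: (cexp (s * (ln n%:R)%:C)) (cexp (- (s * (ln n%:R)%:C))) cE => x y xy.
move: (cexp _) (rGamma_approx _ _) (f k) => p q r.
have -> : s / n%:R * x * (r * (q * (n%:R / (n - k)%:R * y * p))) =
   (n%:R / n%:R) * (x * y) * (r * (s / (n - k)%:R * p * q)) by ring.
by rewrite xy divff // !mul1r.
Qed.

Lemma zeta_coef_asymptotics (B : nat) : exists2 M : R, 0 <= M &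
  forall s a n, normc s <= B%:R -> (0 < n)%N ->
    expseq (fun j => s * (zeta (2 * j)%:R)%:C) a ->
    exists2 d : C, normc d <= M / n%:R &
      a n = s / n%:R * cexp (s * (ln n%:R)%:C) *
        (cexp (s * (ln 2)%:C) * rGamma (1 + s) + d).
Proof.
have ze : pow4_bounded (@zeta_tail R) by move=> j; exact: zeta_tail_pow4_bounded.
have [c c0 hc] := rGamma_rate (B%:R : R).
have [D D0 hD] := expcoef_pow2_bounded B ze.
have [K K0 hK] := pow_le_exp2 R B.+1.
have [K' K0' hK'] := pow2_bounded_sum_pow D (2 * B.+1 + 2).
(* The three summands bound the separate term [f n], the replacement of each approximant and power
   ratio by its limit, and the tail of the sum of [f]. *)
exists (4 * D * K + c * (4 * B.+1%:R + 1) * K' + 2 * c * (8 * D)).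
  by rewrite !addr_ge0 // !mulr_ge0 ?addr_ge0 ?mulr_ge0 // ltW.
move=> s a n sB n0 aP.
have nR : 0 < n%:R :> R by rewrite ltr0n.
have := zeta_coef_decomp n0 aP; cbv zeta.
set f := expcoef _ s => aE; have fD : pow2_bounded D f := hD s sB.
set g := (X in _ * (X + _)) in aE.
set h := (X in _ * (_ + X)) in aE.
set U := rGamma (1 + s).
have F : gsum f = cexp (s * (ln 2)%:C) by rewrite gsum_expcoef // log_value_zeta_tail.
exists (g + (h - U * gsum f)); last by rewrite aE -F; congr (_ * _); ring.
have g1 : normc g <= 4 * D * K / n%:R.
  rewrite /g normcM.
  have e1 : normc (cexp (- (s * (ln n%:R)%:C))) <= n%:R ^+ B.
    apply: le_trans (normc_cexp_le _) _.
    have -> : n%:R ^+ B = expR (B%:R * ln n%:R) :> R by rewrite expRM_natl lnK ?posrE.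
    have l0 : 0 <= ln n%:R :> R by rewrite ln_ge0 // ler1n.
    by rewrite ler_expR normcN normcM normc_real ger0_norm // ler_wpM2r.
  have e2 : normc (\sum_(j < n) (zeta_tail R j.+1)%:C * f (n.-1 - j)%N) <= 4 * D / 2 ^+ n.
    case: (n) n0 => // m _; apply: le_trans (normc_sum _ _ _) _.
    apply: le_trans (_ : \sum_(j < m.+1) zeta_tail R j.+1 * normc (f (m - j)%N) <= _).
      apply: ler_sum => j _; have /andP[z0 _] := ze j.+1 isT.
      by rewrite normcM normc_real ger0_norm.
    apply: le_trans (pow4_conv_le (p := fun i => normc (f i)) ze D0 (fun i _ => fD i)) _.
    by rewrite exprS invfM le_eqVlt; apply/orP; left; apply/eqP; field; rewrite expf_neq0.
  apply: le_trans (ler_pM (normc_ge0 _) (normc_ge0 _) e1 e2) _.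
  rewrite ler_pdivlMr //.
  have -> : n%:R ^+ B * (4 * D / 2 ^+ n) * n%:R = 4 * D * (n%:R ^+ B.+1 / 2 ^+ n) :> R.
    by rewrite exprS; ring.
  rewrite ler_wpM2l ?mulr_ge0 // ler_pdivrMr ?exprn_gt0 //.
  apply: le_trans (hK n); apply: lerXn2r; rewrite ?nnegrE //.
  by rewrite ler_nat.
have U1 : normc U <= 2 * c.
  have [u1 u2] := hc s 1%N sB isT; rewrite divr1 in u2.
  have -> : U = (U - rGamma_approx s 1) + rGamma_approx s 1 by rewrite subrK.
  by apply: le_trans (normcD _ _) _; rewrite /U; lra.
have h1 : normc (h - U * \sum_(k < n) f k) <= c * (4 * B.+1%:R + 1) * K' / n%:R.
  rewrite mulr_sumr /h -sumrB; apply: le_trans (normc_sum _ _ _) _.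
  apply: le_trans (_ : \sum_(k < n) c * (4 * B.+1%:R + 1) / n%:R *
      (normc (f k) * k.+1%:R ^+ (2 * B.+1 + 2)) <= _); last first.
    rewrite -mulr_sumr [leRHS]mulrAC ler_wpM2l ?hK' //.
    by rewrite divr_ge0 ?mulr_ge0 ?addr_ge0 ?mulr_ge0.
  apply: ler_sum => k _.
  have m0 : (0 < n - k)%N by rewrite subn_gt0.
  have [u1 u2] := hc s (n - k)%N sB m0.
  have E1 := cexp_ratio_le sB (ltn_ord k).
  set E := cexp _ in E1 *; set u := rGamma_approx _ _ in u1 u2 *.
  have -> : f k * (u * E) - U * f k = f k * (u * (E - 1) - (U - u)) by ring.
  rewrite normcM [leRHS]mulrCA ler_wpM2l ?normc_ge0 //.
  apply: le_trans (normcB _ _) _; rewrite normcM.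
  set Q := k.+1%:R ^+ (2 * B.+1 + 2) in E1 *.
  have u3 : normc (U - u) <= c / n%:R * Q.
    apply: le_trans u2 _; rewrite -mulrA ler_wpM2l //.
    apply: le_trans (inv_sub_le R (ltn_ord k)) _.
    rewrite mulrC ler_wpM2l ?invr_ge0 // /Q addn2 exprS ler_peMr //.
    by rewrite exprn_ege1 // ler1n.
  have u4 := ler_pM (normc_ge0 _) (normc_ge0 _) u1 E1.
  apply: le_trans (lerD u4 u3) _.
  by rewrite le_eqVlt; apply/orP; left; apply/eqP; ring.
have -> : g + (h - U * gsum f) = g + (h - U * \sum_(k < n) f k) -
   U * (gsum f - \sum_(k < n) f k) by ring.
apply: le_trans (normcB _ _) _; rewrite [leRHS]mulrDl; apply: lerD.
  by apply: le_trans (normcD _ _) _; rewrite [leRHS]mulrDl; exact: lerD.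
rewrite normcM -[leRHS]mulrA; apply: ler_pM; rewrite ?normc_ge0 //.
exact: gsum_rate.
Qed.

End CoefficientAsymptotics.

(** * Bounds on compact sets *)

Section CompactSets.
Set Implicit Arguments.
Unset Strict Implicit.
Variable R : realType.
Local Notation C := R[i].
Implicit Types (A : set C) (f : C -> R).

Lemma lipschitz_continuous f :
  (forall z w, `|f z - f w| <= normc (z - w)) -> continuous f.
Proof.
move=> fL z; have FF : Filter (nbhs z) := nbhs_filter z.
apply/(@cvgrPdist_lt _ _ _ _ FF) => e e0.
have e0' : 0 < e%:C by rewrite ltcR.
near=> w; apply: le_lt_trans (fL _ _) _.
rewrite -ltcR -normc_norm; near: w.
exact: (@cvgr_dist_lt _ C _ (nbhs z) FF id z (@cvg_id _ (nbhs z)) _ e0').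
Unshelve. all: by end_near. Qed.

Lemma normc_dist (z w : C) : `|normc z - normc w| <= normc (z - w).
Proof.
rewrite ler_norml; apply/andP; split.
  by have := normcD (w - z) z; rewrite subrK normc_sub_sym; lra.
by have := normcD (z - w) w; rewrite subrK; lra.
Qed.

Lemma compact_normc_ub A : compact A ->
  exists B : nat, forall z, A z -> normc z <= B%:R.
Proof.
move=> cA; have [A0|/set0P A0] := eqVneq A set0.
  by exists 0%N => z; rewrite A0.
have cf : {within A, continuous (@normc R)}.
  exact/continuous_subspaceT/lipschitz_continuous/normc_dist.
have [w _ hw] := compact_EVT_max A0 cA cf.
have [B _ wB] := normc_ub w; exists B => z Az.
by apply: le_trans wB; apply: hw; rewrite inE.
Qed.

Lemma compact_min A f : compact A ->
  (forall z w, `|f z - f w| <= normc (z - w)) -> (forall z, A z -> 0 < f z) ->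
  exists2 d : R, 0 < d & forall z, A z -> d <= f z.
Proof.
move=> cA fL f0; have [A0|/set0P A0] := eqVneq A set0.
  by exists 1 => // z; rewrite A0.
have cf : {within A, continuous f}.
  exact/continuous_subspaceT/lipschitz_continuous.
have [w /[!inE] Aw hw] := compact_EVT_min A0 cA cf.
by exists (f w) => [|z Az]; [exact: f0|apply: hw; rewrite inE].
Qed.

End CompactSets.

(** * Asymptotics of the expectation *)

Section ExpectationAsymptotics.
Set Implicit Arguments.
Unset Strict Implicit.
Variable R : realType.
Local Notation C := R[i].
Implicit Types (s t : C) (n : nat).

Lemma rGamma_neq0 s : (forall k : nat, s + k.+1%:R != 0) -> rGamma (1 + s) != 0.
Proof.
move=> sk.
have [_ -> //|k|d d0 hd] := @rGamma_lower_bound R [set s] (normc s).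
  exists (normc (s + k.+1%:R)); first by rewrite normc_gt0.
  by move=> _ ->.
by rewrite -normc_gt0; apply: lt_le_trans d0 _; exact: hd.
Qed.

Lemma rGamma_three_halves_neq0 : rGamma (3 / 2 : C) != 0.
Proof.
have -> : 3 / 2 = 1 + 2^-1 :> C by field.
by apply: rGamma_neq0 => k; rewrite paddr_eq0 ?invr_ge0 // pnatr_eq0 andbF.
Qed.

(** Relative to the power of [2n] and to [t Gamma(3/2)], but absolute with respect to
    [1 / Gamma (1 + t/2)], hence meaningful at its zeros. *)
Definition rel_err n t : C :=
  expect (fun s : 'S_n => t ^+ ncycles s) /
    (cpow (2 * n)%:R ((t - 1) / 2) * (t * Gamma (3 / 2))) - rGamma (1 + t / 2).

(** With [d1], [d2] the relative errors of numerator and denominator after removing the powers of 2,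
    the quotient is [V (U + d1) / (V + d2)]. The threshold makes [d2] at most half of [V] in
    modulus. *)
Lemma rel_err_le (B : nat) : exists (M : R) (n0 : nat), forall n t,
  (n0 < n)%N -> t != 0 -> normc t <= B%:R -> normc (rel_err n t) <= M / n%:R.
Proof.
(* [B.+1] bounds both [t / 2] and the parameter [1 / 2] of the denominator. *)
have [M M0 hM] := zeta_coef_asymptotics R B.+1.
have [c c0 hc] := rGamma_rate (B.+1%:R : R).
set V : C := rGamma (3 / 2); have V0 : V != 0 := rGamma_three_halves_neq0.
have v0 : 0 < normc V by rewrite normc_gt0.
set L := 2 ^+ B.+1 * M; have L0 : 0 <= L by rewrite mulr_ge0 ?exprn_ge0.
exists (2 * (normc V + 2 * c) * L / normc V), (Num.bound (2 * L / normc V)) => n t nn0 t0 tB.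
have n0 : (0 < n)%N by apply: leq_ltn_trans nn0.
have nR : 0 < n%:R :> R by rewrite ltr0n.
have Ln : L / n%:R <= normc V / 2.
  rewrite ler_pdivrMr // mulrC mulrA ler_pdivlMr // [L * 2]mulrC -ler_pdivrMr //.
  apply: le_trans (ltW (archi_boundP _)) _; first by rewrite divr_ge0 ?mulr_ge0 // ltW.
  by rewrite ler_nat ltnW.
set s := t / 2.
have sB : normc s <= B.+1%:R.
  rewrite normcM normcV normc_nat; apply: le_trans (_ : B%:R <= _).
    by have := normc_ge0 t; lra.
  by rewrite ler_nat.
have hB : normc (2^-1 : C) <= B.+1%:R.
  rewrite normcV normc_nat; apply: le_trans (_ : 1 <= _); first by lra.
  by rewrite ler1n.
have [a aP] := expseq_exists (fun j => s * (zeta (2 * j)%:R)%:C).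
have [b bP] := expseq_exists (fun j => 2^-1 * ((zeta (2 * j)%:R)%:C : C)).
have EE : expect (fun s : 'S_n => t ^+ ncycles s) = a n / b n.
  apply: expect_expseq.
    move: aP; congr expseq; apply/funext => j; rewrite /theta rmorphM fmorphV rmorph_nat /s.
    by rewrite mulrAC mulrA.
  move: bP; congr expseq; apply/funext => j; rewrite /theta rmorphM fmorphV rmorph_nat.
  by rewrite mulrC.
have [d dM aE] := hM s a n sB n0 aP.
have [d' dM' bE] := hM _ b n hB n0 bP.
set U := rGamma (1 + s) in aE.
have VE : rGamma (1 + 2^-1) = V by rewrite /V; congr rGamma; field.
rewrite VE in bE.
have expB (w : C) : normc w <= B.+1%:R -> normc (cexp (- (w * (ln 2)%:C))) <= 2 ^+ B.+1.
  move=> wB; apply: le_trans (normc_cexp_le _) _.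
  have -> : 2 ^+ B.+1 = expR (B.+1%:R * ln 2) :> R by rewrite expRM_natl lnK ?posrE.
  have l0 : 0 <= ln 2 :> R by rewrite ln_ge0 // ler1n.
  by rewrite ler_expR normcN normcM normc_real ger0_norm // ler_wpM2r.
set P := cexp (s * (ln 2)%:C) in aE; set P' := cexp (- (s * (ln 2)%:C)).
set Q := cexp (2^-1 * (ln 2)%:C) in bE; set Q' := cexp (- (2^-1 * (ln 2)%:C) : C).
have PP : P * P' = 1 := cexpNK _; have QQ : Q * Q' = 1 := cexpNK _.
set d1 := d * P'; set d2 := d' * Q'.
have bnd (x y : C) : normc x <= M / n%:R -> normc y <= 2 ^+ B.+1 -> normc (x * y) <= L / n%:R.
  move=> xM yB; rewrite normcM; apply: le_trans (ler_pM (normc_ge0 _) (normc_ge0 _) xM yB) _.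
  by rewrite [leLHS]mulrC mulrA.
have hd1 : normc d1 <= L / n%:R by apply: bnd => //; exact: expB.
have hd2 : normc d2 <= L / n%:R by apply: bnd => //; exact: expB.
have Vd : normc V / 2 <= normc (V + d2).
  have := normcB (V + d2) d2; rewrite addrK => h.
  by have h2 := le_trans hd2 Ln; lra.
have Vd0 : V + d2 != 0 by rewrite -normc_gt0; apply: lt_le_trans Vd; rewrite divr_gt0.
have errE : rel_err n t = (V * d1 - U * d2) / (V + d2).
  rewrite /rel_err EE aE bE /Gamma -/V -/U natrM cpowE.
  rewrite lnM ?posrE // rmorphD /=.
  have tE : t = s * 2 by rewrite /s divfK // pnatr_eq0.
  have -> : (t - 1) / 2 * ((ln 2)%:C + (ln n%:R)%:C) =
    s * (ln 2)%:C + - (2^-1 * (ln 2)%:C) +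
    (s * (ln n%:R)%:C + - (2^-1 * (ln n%:R)%:C)) by rewrite tE; field.
  have s0 : s != 0 by apply: contra t0 => /eqP s0; rewrite tE s0 mul0r.
  rewrite !cexpD -/P -/Q'.
  have P0 : P != 0 := cexp_neq0 _; have Q0 : Q != 0 := cexp_neq0 _.
  have X0 := cexp_neq0 (s * (ln n%:R)%:C).
  have Y0 := cexp_neq0 (2^-1 * (ln n%:R)%:C : C).
  have YY := cexpNK (2^-1 * (ln n%:R)%:C : C).
  have nz : n%:R != 0 :> C by rewrite pnatr_eq0 -lt0n.
  rewrite -/s -/U tE /d1 /d2 in Vd0 *.
  have Q'E : Q' = Q^-1 by apply: (mulfI Q0); rewrite QQ divff.
  have P'E : P' = P^-1 by apply: (mulfI P0); rewrite PP divff.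
  have Y'E : cexp (- (2^-1 * (ln n%:R)%:C)) = (cexp (2^-1 * (ln n%:R)%:C))^-1 :> C.
    by apply: (mulfI Y0); rewrite YY divff.
  rewrite Q'E P'E Y'E.
  have QVd : Q * V + d' != 0.
    have -> : Q * V + d' = Q * (V + d' * Q') by rewrite Q'E; field.
    by rewrite mulf_neq0.
  have VQd : V * Q + d' != 0 by rewrite mulrC.
  move: (cexp (s * (ln n%:R)%:C)) (cexp (2^-1 * (ln n%:R)%:C)) X0 Y0 => X Y X0 Y0.
  move: (n%:R : C) nz => N nz.
  by field; rewrite ?P0 ?Q0 ?X0 ?Y0 ?nz ?s0 ?V0 ?QVd ?VQd.
have U1 : normc U <= 2 * c.
  have [u1 u2] := hc s 1%N sB isT; rewrite divr1 in u2.
  have -> : U = (U - rGamma_approx s 1) + rGamma_approx s 1 by rewrite subrK.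
  by apply: le_trans (normcD _ _) _; rewrite /U; lra.
rewrite errE normcM normcV.
have num : normc (V * d1 - U * d2) <= (normc V + 2 * c) * (L / n%:R).
  apply: le_trans (normcB _ _) _; rewrite mulrDl (normcM V d1) (normcM U d2); apply: lerD.
    by rewrite ler_wpM2l ?normc_ge0.
  by apply: ler_pM; rewrite ?normc_ge0.
have den : (normc (V + d2))^-1 <= 2 / normc V.
  by rewrite -invf_div lef_pV2 ?posrE ?divr_gt0 // normc_gt0.
have := ler_pM (normc_ge0 _) _ num den; rewrite invr_ge0 normc_ge0 => /(_ isT).
move/le_trans; apply; rewrite le_eqVlt; apply/orP; left; apply/eqP.
by field; rewrite !lt0r_neq0.
Qed.

End ExpectationAsymptotics.

(** * From absolute to relative error *)

Section ErrorTerms.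
Set Implicit Arguments.
Unset Strict Implicit.
Variable R : realType.
Local Notation C := R[i].
Implicit Types (t : C) (n : nat).

(** At [t = 0] division by zero would make [rel_err] equal to [- rGamma 1], which is not small; both
    sides of the expansion vanish there, so 0 is a valid error. *)
Definition abs_err n t : C := if t == 0 then 0 else rel_err n t.

Lemma abs_err_bigO (D : set C) : compactly_bigO_inv D abs_err.
Proof.
move=> A cA _; have [B AB] := compact_normc_ub cA.
have [M [n0 hM]] := rel_err_le R B; exists `|M|, n0.+1 => n t nn At.
rewrite normc_norm lecR /abs_err; case: eqVneq => [_|t0].
  by rewrite normc0 divr_ge0.
apply: le_trans (hM n t nn t0 (AB t At)) _.
by rewrite ler_wpM2r ?invr_ge0 // ler_norm.
Qed.

Lemma expect_abs_err n t : (0 < n)%N ->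
  expect (fun s : 'S_n => t ^+ ncycles s) =
    cpow (2 * n)%:R ((t - 1) / 2) * (t * Gamma (3 / 2)) *
    (rGamma (1 + t / 2) + abs_err n t).
Proof.
move=> n0; rewrite /abs_err; case: eqVneq => [->|t0].
  by rewrite expect0 // mul0r mulr0 mul0r.
have nz : cpow (2 * n)%:R ((t - 1) / 2) * (t * Gamma (3 / 2)) != 0.
  have g0 : Gamma (3 / 2 : C) != 0 by rewrite invr_eq0 rGamma_three_halves_neq0.
  by rewrite cpowE mulf_neq0 ?cexp_neq0 // mulf_neq0.
by rewrite /rel_err [rGamma _ + _]addrC subrK [RHS]mulrC divfK.
Qed.

Lemma rGamma_zeros_shift t (k : nat) : ~ rGamma_zeros t -> t / 2 + k.+1%:R != 0.
Proof.
move=> tz; apply/eqP => h; apply: tz; exists k.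
apply/eqP; rewrite -subr_eq0 opprK natrM.
by rewrite -(divfK (_ : 2 != 0) t) ?pnatr_eq0 // mulrC -mulrDr h mulr0.
Qed.

(** On [A], the distance from [t / 2] to each [-(k+1)] has a positive minimum, as
    [rGamma_lower_bound] requires. *)
Lemma rGamma_zeros_compact_bound (A : set C) :
  compact A -> A `<=` ~` @rGamma_zeros R ->
  exists2 d : R, 0 < d & forall t, A t -> d <= normc (rGamma (1 + t / 2)).
Proof.
move=> cA Az; have [B AB] := compact_normc_ub cA.
have half t : normc (t / 2) <= normc t.
  by rewrite normcM normcV normc_nat; have := normc_ge0 t; lra.
have [|k|d d0 hd] :=
    @rGamma_lower_bound R [set t / 2 | t in A] (B%:R : R); last first.
- by exists d => // t At; apply: hd; exists t.
- have [z w|t At|d d0 hd] :=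
      @compact_min R A (fun t => normc (t / 2 + k.+1%:R)) cA.
  + apply: le_trans (normc_dist _ _) _.
    by rewrite opprD addrACA subrr addr0 -mulrBl half.
  + by rewrite normc_gt0; apply: rGamma_zeros_shift; exact: Az.
  + by exists d => // _ [t At <-]; exact: hd.
- by move=> _ [t At <-]; apply: le_trans (half t) (AB t At).
Qed.

Lemma rGamma_zerosP t : ~ rGamma_zeros t -> rGamma (1 + t / 2) != 0.
Proof. by move=> tz; apply: rGamma_neq0 => k; exact: rGamma_zeros_shift. Qed.

End ErrorTerms.

(* At t = -2, -4, ... the factor 1 / Gamma (1 + t/2) vanishes whereas the
   expectation does not, so the error cannot be relative to it there: the
   relative form is stated away from these points, and on the whole plane
   1 / Gamma (1 + t/2) * (1 + O(1/n)) is read 1 / Gamma (1 + t/2) + O(1/n). *)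
Theorem theorem1p8 (R : realType) :
  (exists err : nat -> R[i] -> R[i],
     compactly_bigO_inv (~` @rGamma_zeros R) err /\
     forall (n : nat) (t : R[i]), (0 < n)%N -> ~ rGamma_zeros t ->
       expect (fun s : 'S_n => t ^+ ncycles s) =
         cpow (2 * n)%:R ((t - 1) / 2) *
         (t * Gamma (3 / 2) * rGamma (1 + t / 2)) * (1 + err n t)) /\
  (exists err : nat -> R[i] -> R[i],
     compactly_bigO_inv setT err /\
     forall (n : nat) (t : R[i]), (0 < n)%N ->
       expect (fun s : 'S_n => t ^+ ncycles s) =
         cpow (2 * n)%:R ((t - 1) / 2) *
         (t * Gamma (3 / 2)) * (rGamma (1 + t / 2) + err n t)).
Proof.
split; last first.
  by exists (@abs_err R); split; [exact: abs_err_bigO|exact: expect_abs_err].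
(* On a compact set avoiding the zeros, dividing by [rGamma (1 + t / 2)] enlarges the constant by at
   most [1 / d]. *)
exists (fun n t => abs_err n t / rGamma (1 + t / 2)); split; last first.
  move=> n t n0 /rGamma_zerosP g0; rewrite expect_abs_err //.
  have -> : rGamma (1 + t / 2) + abs_err n t =
      rGamma (1 + t / 2) * (1 + abs_err n t / rGamma (1 + t / 2)).
    by rewrite mulrDr mulr1 mulrCA divff // mulr1.
  by rewrite !mulrA.
move=> A cA Az; have [M [n0 hM]] := abs_err_bigO cA Az.
have [d d0 hd] := rGamma_zeros_compact_bound cA Az.
exists (M / d), n0 => n t nn At.
rewrite normc_norm lecR normcM normcV mulrAC.
have := hM n t nn At; rewrite normc_norm lecR => h.
apply: ler_pM; rewrite ?normc_ge0 ?invr_ge0 ?normc_ge0 //.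
by rewrite lef_pV2 ?posrE ?(lt_le_trans d0) ?hd.
Qed.
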